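(* Consider the D-ASG iterates $x^{(k+1)}=\mathcal{W}y^{(k)}-\alpha\tilde\nabla F(y^{(k)})$, $y^{(k)}=(1+\beta)x^{(k)}-\beta x^{(k-1)}$, $k\ge 0$, with $\alpha\in\left(0,\frac{\lambda_N^W}{L}\right]$ and $\beta=\frac{1-\sqrt{\alpha\mu}}{1+\sqrt{\alpha\mu}}$. Then, for any $k\ge0$, $$\mathbb{E}\left[\|x^{(k)}-x^\infty\|^2\right]\le2\left(1-\sqrt{\alpha\mu}\right)^k\frac{V_{S,\alpha}(\xi_0)}{\mu}+\frac{\sigma^2N\sqrt\alpha}{\mu\sqrt\mu}\left(2-\lambda_N^W+\alpha L\right).$$ Therefore $J_\infty(\alpha):=\frac{1}{\sigma^2N}\limsup_{k\to\infty}\mathrm{Var}(x^{(k)})$ satisfies $$J_\infty(\alpha)\le\frac{\sqrt\alpha}{\mu\sqrt\mu}\left(2-\lambda_N^W+\alpha L\right).$$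
   Context: Functions: $f_1,\dots,f_N:\mathbb{R}^d\to\mathbb{R}$ are each $\mu$-strongly convex with $L$-Lipschitz gradient ($0<\mu\le L$). $F:\mathbb{R}^{Nd}\to\mathbb{R}$, $F(x_1,\dots,x_N)=\sum_{i=1}^N f_i(x_i)$. Network: $(\mathcal V,\mathcal E)$ is a connected undirected graph on $\{1,\dots,N\}$; $W$ is a symmetric doubly stochastic $N\times N$ matrix with, for $i\ne j$, $W_{ij}>0$ if $(i,j)\in\mathcal E$ and $W_{ij}=0$ otherwise, and $W_{ii}=1-\sum_{j\neq i}W_{ij}>0$. Its eigenvalues are $1=\lambda_1^W>\lambda_2^W\ge\cdots\ge\lambda_N^W$, and it is assumed that $\lambda_N^W>0$. $\mathcal{W}:=W\otimes I_d$. Iterates: $x^{(k)},y^{(k)}\in\mathbb{R}^{Nd}$ stack the node variables $x_i^{(k)},y_i^{(k)}\in\mathbb{R}^d$; $x^{(0)},x^{(-1)}$ are deterministic; $\tilde\nabla F(y^{(k)})$ stacks the stochastic gradients $\tilde\nabla f_i(y_i^{(k)})=\tilde\nabla f_i(y_i^{(k)},w_i^{(k)})$. Noise: $w_i^{(k)}$ is a random variable independent of all $w_j^{(t)}$ with $t<k$ and of $w_j^{(k)}$, $j\neq i$, and $\mathbb{E}[\tilde\nabla f_i(y_i^{(k)},w_i^{(k)})\,|\,y_i^{(k)}]=\nabla f_i(y_i^{(k)})$, $\mathbb{E}[\|\tilde\nabla f_i(y_i^{(k)},w_i^{(k)})-\nabla f_i(y_i^{(k)})\|^2\,|\,y_i^{(k)}]\le\sigma^2$,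 with $\sigma>0$ where $J_\infty$ is considered. Penalized objective: $F_{\mathcal W,\alpha}(x):=\frac{1}{2\alpha}x^T(I_{Nd}-\mathcal W)x+F(x)$. $x^\infty\in\mathbb{R}^{Nd}$ is its unique minimizer, equivalently the unique solution of $(I_{Nd}-\mathcal W)x^\infty+\alpha\nabla F(x^\infty)=0$. Lyapunov function: $V_{S,\alpha}(\xi):=\xi^TS_\alpha\xi+F_{\mathcal W,\alpha}(T\xi+x^\infty)-F_{\mathcal W,\alpha}(x^\infty)$ for $\xi\in\mathbb{R}^{2Nd}$, with $T=[1\ \ 0]\otimes I_{Nd}$, $S_\alpha=\tilde S_\alpha\otimes I_{Nd}$, $\tilde S_\alpha=vv^T$, $v=\left[\frac{1}{\sqrt{2\alpha}},\ \sqrt{\frac{\mu}{2}}-\sqrt{\frac{1}{2\alpha}}\right]^T$; $\xi_0=[(x^{(0)}-x^\infty)^T,(x^{(-1)}-x^\infty)^T]^T$. For a random vector $X$, $\mathrm{Var}(X)=\mathbb{E}\|X-\mathbb{E}X\|^2$. *)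

(* Defs.v *)
From HB Require Import structures.
From mathcomp Require Import all_boot all_order all_algebra.
From mathcomp Require Import mxtens.
From mathcomp Require Import all_classical all_reals all_analysis.

Set Implicit Arguments.
Unset Strict Implicit.
Unset Printing Implicit Defensive.

Import Order.TTheory GRing.Theory Num.Theory.
Import numFieldNormedType.Exports.

Local Open Scope classical_set_scope.
Local Open Scope ring_scope.

Section EuclideanSpace.
Context {R : realType}.

(* The library norm on matrices is the sup norm, hence these definitions. *)
Definition sqnorm n (x : 'cV[R]_n) : R := \sum_(i < n) x i 0 ^+ 2.

Definition enorm n (x : 'cV[R]_n) : R := Num.sqrt (sqnorm x).

(* R^(mn) as m stacked blocks of size n, indexed consistently with tensmx. *)
Definition stack m n (x : 'I_m -> 'cV[R]_n) : 'cV[R]_(m * n) :=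
  \col_k x (mxtens_unindex k).1 (mxtens_unindex k).2 0.

Definition block m n (x : 'cV[R]_(m * n)) (i : 'I_m) : 'cV[R]_n :=
  \col_j x (mxtens_index (i, j)) 0.

Definition gradient n (f : 'cV[R]_n -> R) (x : 'cV[R]_n) : 'cV[R]_n :=
  \col_j 'D_(delta_mx j 0) f x.

Definition strongly_convex (mu : R) n (f : 'cV[R]_n -> R) : Prop :=
  forall (x y : 'cV[R]_n) (t : R), 0 <= t <= 1 ->
    f (t *: x + (1 - t) *: y) <=
      t * f x + (1 - t) * f y - mu / 2 * (t * (1 - t)) * sqnorm (x - y).

Definition lipschitz_gradient (L : R) n (f : 'cV[R]_n -> R) : Prop :=
  (forall x, differentiable f x) /\
  (forall x y, enorm (gradient f x - gradient f y) <= L * enorm (x - y)).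

End EuclideanSpace.

Section Network.
Context {R : realType}.

(* Only pairs i != j of the relation e matter: self-loops are ignored. *)
Definition connected_graph N (e : rel 'I_N) : Prop :=
  symmetric e /\ (forall i j, connect e i j).

Definition doubly_stochastic N (W : 'M[R]_N) : Prop :=
  [/\ forall i j, 0 <= W i j,
      forall i, \sum_j W i j = 1
    & forall j, \sum_i W i j = 1].

Definition mixing_matrix N (e : rel 'I_N) (W : 'M[R]_N) : Prop :=
  [/\ W^T = W,
      doubly_stochastic W,
      forall i j, i != j -> (e i j -> 0 < W i j) /\ (~~ e i j -> W i j = 0)
    & forall i, W i i = 1 - \sum_(j | j != i) W i j /\ 0 < W i i].

(* lam lists the eigenvalues with multiplicity, in nonincreasing order. *)
Definition eigenvalues N (W : 'M[R]_N) (lam : N.-tuple R) : Prop :=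
  char_poly W = \prod_(a <- lam) ('X - a%:P) /\ sorted >=%R lam.

Definition lift_mx N d (W : 'M[R]_N) : 'M[R]_(N * d) := tensmx W (1%:M : 'M[R]_d).

End Network.

Section Objective.
Context {R : realType} {N d : nat}.
Variables (f : 'I_N -> 'cV[R]_d -> R) (W : 'M[R]_N) (alpha mu : R).

Definition objective (x : 'cV[R]_(N * d)) : R := \sum_(i < N) f i (block x i).

Definition penalized (x : 'cV[R]_(N * d)) : R :=
  (2 * alpha)^-1 * (x^T *m (1%:M - lift_mx d W) *m x) 0 0 + objective x.

Definition lyap_v : 'cV[R]_2 :=
  \col_i (if i == 0 then (Num.sqrt (2 * alpha))^-1
          else Num.sqrt (mu / 2) - Num.sqrt ((2 * alpha)^-1)).

Definition lyap_S : 'M[R]_(2 * (N * d)) :=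
  tensmx (lyap_v *m lyap_v^T) (1%:M : 'M[R]_(N * d)).

Definition lyap_T : 'M[R]_(N * d, 2 * (N * d)) :=
  castmx (mul1n (N * d), erefl)
    (tensmx (\row_(j < 2) (if j == 0 then 1 else 0)) (1%:M : 'M[R]_(N * d))).

Definition lyapunov (xinf : 'cV[R]_(N * d)) (xi : 'cV[R]_(2 * (N * d))) : R :=
  (xi^T *m lyap_S *m xi) 0 0 +
  penalized (lyap_T *m xi + xinf) - penalized xinf.

End Objective.

Section Algorithm.
Context {R : realType} {N d : nat} {E : Type}.
Variables (G : 'I_N -> 'cV[R]_d -> E -> 'cV[R]_d) (W : 'M[R]_N).
Variables (alpha beta : R) (x0 xm1 : 'cV[R]_(N * d)) (w : 'I_N -> nat -> E).

Definition stoch_grad (y : 'cV[R]_(N * d)) (v : 'I_N -> E) : 'cV[R]_(N * d) :=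
  stack (fun i => G i (block y i) (v i)).

Definition extrapolate (s : 'cV[R]_(N * d) * 'cV[R]_(N * d)) :=
  (1 + beta) *: s.1 - beta *: s.2.

(* The pair (x^(k), x^(k-1)) along the noise realization w. *)
Fixpoint dasg (k : nat) : 'cV[R]_(N * d) * 'cV[R]_(N * d) :=
  if k is j.+1 then
    let y := extrapolate (dasg j) in
    (lift_mx d W *m y - alpha *: stoch_grad y (fun i => w i j), (dasg j).1)
  else (x0, xm1).

Definition dasg_x (k : nat) : 'cV[R]_(N * d) := (dasg k).1.

Definition dasg_y (k : nat) : 'cV[R]_(N * d) := extrapolate (dasg k).

End Algorithm.

Section Probability.
Context {disp : measure_display} {T : measurableType disp} {R : realType}.
Variable P : probability T R.

(* The sigma-algebra generated by the maps X i, for i in D. *)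
Definition sigma_of (I : Type) (dE : measure_display) (E : measurableType dE)
    (D : set I) (X : I -> T -> E) : set (set T) :=
  <<s \bigcup_(i in D) preimage_set_system setT (X i) measurable >>.

Definition sigma_of_vector n (Y : T -> 'cV[R]_n) : set (set T) :=
  sigma_of setT (fun (j : 'I_n) (t : T) => Y t j 0).

Definition independent_sigma (F G : set (set T)) : Prop :=
  forall A B, F A -> G B -> P (A `&` B) = (P A * P B)%E.

(* Z is a version of the conditional expectation of X given the
   sub-sigma-algebra G. *)
Definition is_cond_exp (G : set (set T)) (X Z : T -> R) : Prop :=
  [/\ P.-integrable setT (EFin \o X),
      P.-integrable setT (EFin \o Z),
      forall B : set R, measurable B -> G (Z @^-1` B)
    & forall A, G A ->
        (\int[P]_(t in A) (Z t)%:E = \int[P]_(t in A) (X t)%:E)%E].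

Definition vector_mean n (X : T -> 'cV[R]_n) : 'cV[R]_n :=
  \col_j fine ('E_P[fun t => (X t j 0)%R])%E.

Definition vector_var n (X : T -> 'cV[R]_n) : \bar R :=
  ('E_P[fun t => sqnorm (X t - vector_mean X)%R])%E.

Definition J_infty (sigma : R) N d
    (x : nat -> T -> 'cV[R]_(N * d)) : \bar R :=
  (((sigma ^+ 2 * N%:R)^-1)%:E * limn_esup (fun k => vector_var (x k)))%E.

(* w i k is jointly independent of the family of all w j t with t < k
   together with all w j k with j != i. *)
Definition noise_independent N (dE : measure_display) (E : measurableType dE)
    (w : 'I_N -> nat -> T -> E) : Prop :=
  forall i k,
    independent_sigma
      (sigma_of [set i] (fun j => w j k))
      (sigma_of [set jt : 'I_N * nat | (jt.2 < k)%N \/ (jt.2 = k /\ jt.1 != i)]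
         (fun jt => w jt.1 jt.2)).

Definition unbiased_oracle n (g : 'cV[R]_n -> 'cV[R]_n)
    (Y X : T -> 'cV[R]_n) : Prop :=
  forall j : 'I_n,
    is_cond_exp (sigma_of_vector Y) (fun t => X t j 0) (fun t => g (Y t) j 0).

Definition bounded_variance_oracle (sigma : R) n (g : 'cV[R]_n -> 'cV[R]_n)
    (Y X : T -> 'cV[R]_n) : Prop :=
  exists Z : T -> R,
    is_cond_exp (sigma_of_vector Y) (fun t => sqnorm (X t - g (Y t))) Z /\
    {ae P, forall t, Z t <= sigma ^+ 2}.

End Probability.

(* R^n carries its product (= Borel) sigma-algebra through n.-tuple R. *)
Definition jointly_measurable {R : realType} {n : nat} {dE : measure_display}
    {E : measurableType dE} (g : 'cV[R]_n -> E -> 'cV[R]_n) : Prop :=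
  forall j : 'I_n,
    measurable_fun setT
      (fun p : n.-tuple R * E => g (\col_i tnth p.1 i) p.2 j 0).

(* Main.v *)
(* With F_W the penalized objective, W y - alpha grad F(y) = y - alpha grad F_W(y),
   so D-ASG is the accelerated stochastic gradient method of step alpha on F_W,
   which is mu-strongly convex and Lam-smooth for Lam = (1 - lam_N) / alpha + L,
   and alpha <= lam_N / L says exactly that alpha Lam <= 1. Along every noise
   realization the Lyapunov function satisfies
     V_(k+1) <= (1 - sqrt (alpha mu)) V_k + <u_k, e_k>
                + alpha / 2 (1 + alpha Lam) |e_k|^2
   with e_k the gradient noise and u_k a function of the past. Iterating this
   before taking expectations leaves only the means of the last two terms: the
   first one vanishes, the second one is at most N sigma^2 up to its factor, and
   mu / 2 |x_k - xinf|^2 <= V_k. The hypotheses only center e_k given y_k;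
   independence of the samples and Fubini's theorem upgrade this to centering
   given the whole past. *)
Require Import Defs.
From HB Require Import structures.
From mathcomp Require Import all_boot all_order all_algebra.
From mathcomp Require Import mxtens complex.
From mathcomp Require Import all_classical all_reals all_analysis.
From mathcomp Require Import measurable_realfun.
From mathcomp Require Import ring lra.

Set Implicit Arguments.
Unset Strict Implicit.
Unset Printing Implicit Defensive.

Import Order.TTheory GRing.Theory Num.Theory.
Import numFieldNormedType.Exports.

Local Open Scope classical_set_scope.
Local Open Scope ring_scope.

(** * The accelerated gradient step *)

Section Dot.
Context {R : realType} {n : nat}.
Implicit Types (u v z : 'cV[R]_n) (a : R).

Definition dot u v : R := \sum_(i < n) u i 0 * v i 0.

Lemma dotE u v : (u^T *m v) 0 0 = dot u v.
Proof. by rewrite mxE; apply: eq_bigr => i _; rewrite mxE. Qed.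

Lemma dotC u v : dot u v = dot v u.
Proof. by apply: eq_bigr => i _; rewrite mulrC. Qed.

Lemma dotDl u v z : dot (u + v) z = dot u z + dot v z.
Proof. by rewrite -big_split; apply: eq_bigr => i _; rewrite mxE mulrDl. Qed.

Lemma dotZl a u v : dot (a *: u) v = a * dot u v.
Proof. by rewrite mulr_sumr; apply: eq_bigr => i _; rewrite mxE mulrA. Qed.

Lemma dotDr u v z : dot u (v + z) = dot u v + dot u z.
Proof. by rewrite dotC dotDl !(dotC u). Qed.

Lemma dotZr a u v : dot u (a *: v) = a * dot u v.
Proof. by rewrite dotC dotZl dotC. Qed.

Lemma dotNl u v : dot (- u) v = - dot u v.
Proof. by rewrite -scaleN1r dotZl mulN1r. Qed.

Lemma dotNr u v : dot u (- v) = - dot u v.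
Proof. by rewrite dotC dotNl dotC. Qed.

Lemma dotxx u : dot u u = sqnorm u.
Proof. by []. Qed.

Lemma sqnorm_ge0 u : 0 <= sqnorm u.
Proof. by apply: sumr_ge0 => i _; rewrite sqr_ge0. Qed.

Lemma sqnormZ a u : sqnorm (a *: u) = a ^+ 2 * sqnorm u.
Proof. by rewrite -!dotxx dotZl dotZr mulrA. Qed.

Lemma sqnormD_le u v : sqnorm (u + v) <= 2 * sqnorm u + 2 * sqnorm v.
Proof.
rewrite /sqnorm !mulr_sumr -big_split; apply: ler_sum => i _ /=; rewrite mxE.
by have := sqr_ge0 (u i 0 - v i 0); nra.
Qed.

Lemma sqr_coord_le u i : u i 0 ^+ 2 <= sqnorm u.
Proof.
rewrite /sqnorm (bigD1 i)//= lerDl.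
by apply: sumr_ge0 => j _; rewrite sqr_ge0.
Qed.

(** The slack is [(2 * a)^-1] times the squared norm of [u - a *: v]. The free weight [a] lets a
    bound on one factor be converted into a multiple of the squared norm of the other. *)
Lemma dot_young u v a : 0 < a ->
  dot u v <= (2 * a)^-1 * sqnorm u + a / 2 * sqnorm v.
Proof.
move=> a0; rewrite /dot /sqnorm !mulr_sumr -big_split; apply: ler_sum => i _ /=.
rewrite -subr_ge0.
rewrite [X in _ <= X](_ : _ = (2 * a)^-1 * (u i 0 - a * v i 0) ^+ 2).
  by rewrite mulr_ge0 ?sqr_ge0// invr_ge0 mulr_ge0 ?ltW.
by field; rewrite gt_eqF.
Qed.

Lemma enorm_ge0 u : 0 <= enorm u.
Proof. exact: sqrtr_ge0. Qed.

Lemma sqr_enorm u : enorm u ^+ 2 = sqnorm u.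
Proof. by rewrite sqr_sqrtr// sqnorm_ge0. Qed.

End Dot.

Section AcceleratedStep.
Context {R : realType} {n : nat}.
Variables (Phi : 'cV[R]_n -> R) (g : 'cV[R]_n -> 'cV[R]_n).
Variables (mu Lam alpha : R) (xs : 'cV[R]_n).
Hypotheses (mu_gt0 : 0 < mu) (alpha_gt0 : 0 < alpha).
Hypothesis Lam_le : alpha * Lam <= 1.
Hypothesis rho_le1 : Num.sqrt (alpha * mu) <= 1.
Hypothesis Phi_lower : forall y z,
  Phi y + dot (g y) (z - y) + mu / 2 * sqnorm (z - y) <= Phi z.
Hypothesis Phi_upper : forall y z,
  Phi z <= Phi y + dot (g y) (z - y) + Lam / 2 * sqnorm (z - y).

Let rho := Num.sqrt (alpha * mu).

(** The Lyapunov function in unstacked variables: its matrix [v v^T] has rank one, and [v] is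
    [(2 alpha)^(-1/2)] times [(1, -(1 - rho))]. *)
Definition energy (x x' : 'cV[R]_n) : R :=
  (2 * alpha)^-1 * sqnorm (x - xs - (1 - rho) *: (x' - xs)) + (Phi x - Phi xs).

(** Collects everything that multiplies [eps] linearly when the step below is expanded; it depends
    on [x] and [y] only. *)
Definition cross (x y : 'cV[R]_n) : 'cV[R]_n :=
  (Lam * alpha ^+ 2) *: g y - (y - (1 - rho) *: x - rho *: xs).

(** Smoothness bounds [Phi] at the new point, and the strong convexity bounds at [x] and [xs], both
    based at [y], are weighted by [1 - rho] and [rho]. All values of [Phi] cancel, which leaves a
    quadratic inequality between vectors. *)
Lemma energy_step (beta : R) (x x' y eps : 'cV[R]_n) :
  beta = (1 - rho) / (1 + rho) -> y = (1 + beta) *: x - beta *: x' ->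
  energy (y - alpha *: (g y + eps)) x <=
    (1 - rho) * energy x x' + dot (cross x y) eps
    + alpha / 2 * (1 + alpha * Lam) * sqnorm eps.
Proof.
move=> betaE yE; set xp := y - alpha *: (g y + eps).
have rho_gt0 : 0 < rho by rewrite sqrtr_gt0 mulr_gt0.
have rho2 : rho ^+ 2 = alpha * mu by rewrite sqr_sqrtr// ltW// mulr_gt0.
suff key : (2 * alpha)^-1 * sqnorm (xp - xs - (1 - rho) *: (x - xs))
    + dot (g y) (xp - y) + Lam / 2 * sqnorm (xp - y) <=
    (1 - rho) * (2 * alpha)^-1 * sqnorm (x - xs - (1 - rho) *: (x' - xs))
    + (1 - rho) * dot (g y) (x - y) + (1 - rho) * (mu / 2) * sqnorm (x - y)
    + rho * dot (g y) (xs - y) + rho * (mu / 2) * sqnorm (xs - y)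
    + dot (cross x y) eps + alpha / 2 * (1 + alpha * Lam) * sqnorm eps.
  have H1 := Phi_upper y xp.
  have H2 : 0 <= (1 - rho) * (Phi x - (Phi y + dot (g y) (x - y)
     + mu / 2 * sqnorm (x - y))) by rewrite mulr_ge0 ?subr_ge0.
  have H3 : 0 <= rho * (Phi xs - (Phi y + dot (g y) (xs - y)
     + mu / 2 * sqnorm (xs - y))) by rewrite mulr_ge0 ?subr_ge0// ltW.
  by rewrite /energy; lra.
(* Both sides are sums over coordinates of one quadratic expression, so a scalar inequality
   suffices. *)
rewrite /dot /sqnorm !mulr_sumr -!big_split; apply: ler_sum => i _ /=.
rewrite /cross /xp !mxE -subr_ge0.
have -> : y i 0 = (1 + beta) * x i 0 - beta * x' i 0 by rewrite yE !mxE.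
move: (x i 0) (x' i 0) (xs i 0) (g y i 0) (eps i 0) => a a' s G e.
have -> : mu = rho ^+ 2 / alpha by rewrite rho2 mulrC mulKf// gt_eqF.
(* The terms linear in [G] cancel, and for this [beta] the remaining quadratic terms collapse to a
   multiple of [(a - a') ^+ 2]. Nonnegativity then rests on [alpha * Lam <= 1] and [rho <= 1]. *)
rewrite [X in 0 <= X](_ : _ = alpha / 2 * (1 - alpha * Lam) * G ^+ 2 +
   (2 * alpha)^-1 * ((1 - rho) * rho * (1 + rho)) * (beta * (a - a')) ^+ 2).
  have r1 : 0 <= 1 - rho by rewrite subr_ge0.
  have [a0 r0] := (ltW alpha_gt0, ltW rho_gt0).
  apply: addr_ge0; apply: mulr_ge0; rewrite ?sqr_ge0//; apply: mulr_ge0.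
  - exact: divr_ge0.
  - by rewrite subr_ge0.
  - by rewrite invr_ge0 mulr_ge0.
  - by apply: mulr_ge0; [exact: mulr_ge0 | exact: addr_ge0].
by rewrite betaE; field; rewrite !gt_eqF// addr_gt0.
Qed.

End AcceleratedStep.

(** * Gradient inequalities *)

Section GradientInequalities.
Context {R : realType} {n : nat}.
Variable f : 'cV[R]_n -> R.

(** The gradient is defined through partial derivatives; linearity of the differential gives the
    other directions. *)
Lemma dot_gradient (x v : 'cV[R]_n) :
  differentiable f x -> dot (gradient f x) v = 'D_v f x.
Proof.
move=> df; rewrite deriveE//.
have {2}-> : v = \sum_(i < n) v i 0 *: delta_mx i 0.
  by rewrite {1}(matrix_sum_delta v); apply: eq_bigr => i _; rewrite big_ord1.
rewrite linear_sum /dot; apply: eq_bigr => i _.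
by rewrite linearZ mxE deriveE// mulrC.
Qed.

Lemma line_derive (x v : 'cV[R]_n) (t : R) : differentiable f (x + t *: v) ->
  is_derive t 1 (fun s : R => f (x + s *: v)) (dot (gradient f (x + t *: v)) v).
Proof.
move=> df; rewrite dot_gradient//.
have : is_derive (x + t *: v) v f ('D_v f (x + t *: v)).
  exact/derivableP/diff_derivable.
case=> dfv _.
have E : (fun h : R => h^-1 *: (((fun s : R => f (x + s *: v)) \o shift t) (h *: 1) -
    f (x + t *: v))) = (fun h => h^-1 *: ((f \o shift (x + t *: v)) (h *: v) - f (x + t *: v))).
  apply/funext => h /=; congr (_ *: (f _ - _)).
  by rewrite -[h *: 1]/(h * 1) mulr1 scalerDl addrCA.
by apply: DeriveDef; rewrite /derivable /derive E.
Qed.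

(** Strong convexity at [h *: z + (1 - h) *: y], divided by [h], bounds the difference quotient of
    [f] at [y] along [z - y]; then [h] tends to 0 from the right. *)
Lemma strongly_convex_lower (mu : R) (y z : 'cV[R]_n) :
  strongly_convex mu f -> differentiable f y ->
  f y + dot (gradient f y) (z - y) + mu / 2 * sqnorm (z - y) <= f z.
Proof.
move=> sc df.
set v := z - y; set c := mu / 2 * sqnorm v.
have dfv : derivable f y v by exact: diff_derivable.
have fE := dot_gradient v df.
have dcv : h^-1 *: ((f \o shift y) (h *: v) - f y) @[h --> 0^'+] --> dot (gradient f y) v.
  by rewrite fE; apply: cvg_dnbhs_at_right.
have lin : f z - f y - (1 - h) * c @[h --> 0^'+] --> f z - f y - (1 - 0) * c.
  apply: cvg_at_right_filter; apply: cvgB; first exact: cvg_cst.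
  by apply: cvgM; [apply: cvgB; [exact: cvg_cst | exact: cvg_id] | exact: cvg_cst].
suff : dot (gradient f y) v <= f z - f y - (1 - 0) * c by rewrite subr0 mul1r; lra.
apply: (ler_cvg_to dcv lin); near=> h.
have h0 : 0 < h by near: h; exact: nbhs_right_gt.
have h1 : h <= 1 by near: h; exact: nbhs_right_le.
have := sc z y h; rewrite (ltW h0) h1 => /(_ isT).
have -> : h *: z + (1 - h) *: y = h *: v + y.
  by rewrite /v scalerBr scalerBl scale1r addrA addrAC.
rewrite -/v /= => hc; rewrite -(ler_pM2l h0).
rewrite -[_ *: (_ - _)]/(h^-1 * _) mulVKf ?gt_eqF// /c; lra.
Unshelve. all: by end_near.
Qed.

(** Along the segment from [y] to [z], [f] minus its quadratic upper model has a nonpositive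
    derivative, so it does not increase from [t = 0] to [t = 1]. *)
Lemma descent_lemma (L : R) (y z : 'cV[R]_n) : 0 < L -> lipschitz_gradient L f ->
  f z <= f y + dot (gradient f y) (z - y) + L / 2 * sqnorm (z - y).
Proof.
move=> L0 [df lip]; set v := z - y.
pose phi (t : R) := f (y + t *: v) - (t * dot (gradient f y) v + t ^+ 2 * (L / 2 * sqnorm v)).
have dphi (t : R) : is_derive t 1 phi (dot (gradient f (y + t *: v)) v -
    (dot (gradient f y) v + t * L * sqnorm v)).
  have d1 := line_derive (df (y + t *: v)).
  have d2 := is_deriveZ (dot (gradient f y) v) (is_derive_id t (1 : R)).
  have d3 := is_deriveZ (L / 2 * sqnorm v) (is_deriveX 2 (is_derive_id t (1 : R))).
  have := is_deriveB d1 (is_deriveD d2 d3).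
  rewrite (_ : _ - _ = phi) => [d|]; last first.
    by apply/funext => s; rewrite /phi !fctE /GRing.scale/= /GRing.scale/=; ring.
  apply: (is_derive_eq d).
  by rewrite /GRing.scale/=; field.
suff : phi 1 <= phi 0.
  rewrite /phi scale1r scale0r addr0 mul1r mul0r expr1n mul1r expr0n/= mul0r addr0 subr0 /v.
  by rewrite (addrC y) subrK; lra.
apply: (@ler0_derive1_le_cc _ phi 0 1) => //.
- move=> t /andP[t0 _]; rewrite derive1E; have [_ ->] := dphi t.
  move: t0; rewrite bnd_simp => t0.
  suff : dot (gradient f (y + t *: v) - gradient f y) v <= t * L * sqnorm v.
    by rewrite dotDl dotNl; lra.
  have tL0 : 0 < t * L by rewrite mulr_gt0.
  (* The gradients differ in norm by at most [t * L] times that of [v]; with weight [t * L] each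
     half of Young's bound is then at most [t * L / 2 * sqnorm v]. *)
  apply: (le_trans (dot_young _ _ tL0)).
  suff : (2 * (t * L))^-1 * sqnorm (gradient f (y + t *: v) - gradient f y) <= t * L / 2 * sqnorm v.
    by lra.
  rewrite ler_pdivrMl ?mulr_gt0// -!sqr_enorm.
  have := lip (y + t *: v) y; rewrite (addrC y) addrK => le1.
  apply: le_trans (_ : (L * enorm (t *: v)) ^+ 2 <= _).
    by rewrite ler_sqr// ?nnegrE ?mulr_ge0 ?enorm_ge0// ltW.
  rewrite exprMn !sqr_enorm sqnormZ.
  by lra.
- by apply: derivable_within_continuous => t _; have [] := dphi t.
- by rewrite in_itv/= lexx ler01.
- by rewrite in_itv/= lexx ler01.
Qed.

End GradientInequalities.

(** * The Rayleigh quotient of a symmetric matrix *)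

Section Spectrum.
Context {R : realType} {n : nat}.

(** Over the complex numbers [W] is normal, hence unitarily diagonalizable. In the coordinates
    [u = P v] both quadratic forms become sums of squared moduli, weighted by the eigenvalues on one
    side. *)
Lemma symmetric_quadratic_ge (W : 'M[R]_n) (s : seq R) (c : R) :
  W^T = W -> char_poly W = \prod_(a <- s) ('X - a%:P) ->
  (forall a, a \in s -> c <= a) ->
  forall x : 'cV[R]_n, c * sqnorm x <= dot x (W *m x).
Proof.
move=> Wsym Wchar sc x.
pose toC := real_complex R.
pose A := map_mx toC W; pose v := map_mx toC x.
have realC (r : R) : toC r \is Num.real by rewrite complex_real.
have Anormal : A \is normalmx.
  apply: symmetric_normalmx; last by apply/mxOverP => i j; rewrite mxE realC.
  apply/is_hermitianmxP; rewrite expr0 scale1r.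
  by apply/matrixP => i j; rewrite !mxE -[in LHS]Wsym mxE.
have /orthomx_spectralP := Anormal.
set P := spectralmx A; set D := spectral_diag A => AE.
have Punit : P \in unitmx := spectral_unit A.
have PV : invmx P = (P ^t*)%sesqui by rewrite invmx_unitary// spectral_unitarymx.
(* Row [i] of [P] is an eigenvector for [D 0 i], nonzero because [P] is invertible; so [D 0 i] is a
   root of the characteristic polynomial and comes from an element of [s]. *)
have Dge i : toC c <= D 0 i.
  have rD : eigenvalue A (D 0 i).
    apply/eigenvalueP; exists (row i P).
      rewrite -row_mul AE !mulmxA mulmxV// mul1mx.
      by apply/rowP => j; rewrite mul_diag_mx !mxE.
    apply: contraTneq Punit => Pi0; rewrite unitmxE (expand_det_row _ i) big1 ?unitr0// => j _.
    by have /rowP/(_ j) := Pi0; rewrite !mxE => ->; rewrite mul0r.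
  move: rD; rewrite eigenvalue_root_char -map_char_poly Wchar rmorph_prod/=.
  rewrite [X in root X](_ : _ = \prod_(b <- [seq toC a | a <- s]) ('X - b%:P)).
    by rewrite root_prod_XsubC => /mapP[a /sc ca ->]; rewrite lecR.
  by rewrite big_map; apply: eq_bigr => a _; rewrite rmorphB/= map_polyX map_polyC.
pose u := P *m v.
have vT : v^T *m (P ^t*)%sesqui = (u ^t*)%sesqui.
  rewrite /u trmx_mul map_mxM/=; congr (_ *m _).
  by apply/matrixP => i j; rewrite !mxE (CrealP (realC _)).
have E1 : toC (dot x (W *m x)) = \sum_i D 0 i * `|u i 0| ^+ 2.
  transitivity ((v^T *m (A *m v)) 0 0).
    by rewrite -dotE /v /A -map_mxM map_trmx -map_mxM [RHS]mxE.
  rewrite {1}AE PV !mulmxA vT -!mulmxA -/u mxE; apply: eq_bigr => i _.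
  by rewrite mul_diag_mx !mxE normCK mulrCA [_^* * _]mulrC.
have E2 : toC (sqnorm x) = \sum_i `|u i 0| ^+ 2.
  transitivity ((v^T *m (1%:M *m v)) 0 0).
    by rewrite -dotxx -dotE mul1mx /v map_trmx -map_mxM [RHS]mxE.
  rewrite -(mulVmx Punit) PV !mulmxA vT -!mulmxA -/u mxE; apply: eq_bigr => i _.
  by rewrite !mxE normCK mulrC.
rewrite -lecR rmorphM/= -/toC E1 E2 mulr_sumr; apply: ler_sum => i _.
by rewrite ler_wpM2r// exprn_ge0.
Qed.

End Spectrum.

(** * The penalized objective *)

Section Stacking.
Context {R : realType} {m n : nat}.
Implicit Types x y : 'cV[R]_(m * n).

Lemma sum_mxtens (F : 'I_(m * n) -> R) :
  \sum_k F k = \sum_i \sum_j F (mxtens_index (i, j)).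
Proof.
rewrite pair_big (reindex (@mxtens_index m n))/=; last first.
  by exists (@mxtens_unindex m n) => k _; rewrite ?mxtens_indexK ?mxtens_unindexK.
by apply: eq_bigr => -[].
Qed.

(** Dual to [block]: one coordinate across all nodes. [lift_mx] mixes nodes and keeps coordinates
    apart, so it acts on each slice as [W]. *)
Definition slice x (j : 'I_n) : 'cV[R]_m := \col_i x (mxtens_index (i, j)) 0.

Lemma stackE (u : 'I_m -> 'cV[R]_n) i j :
  stack u (mxtens_index (i, j)) 0 = u i j 0.
Proof. by rewrite mxE mxtens_indexK. Qed.

Lemma blockB x y i : block (x - y) i = block x i - block y i.
Proof. by apply/colP => j; rewrite !mxE. Qed.

Lemma sqnorm_block x : sqnorm x = \sum_i sqnorm (block x i).
Proof.
rewrite /sqnorm sum_mxtens; apply: eq_bigr => i _.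
by apply: eq_bigr => j _; rewrite mxE.
Qed.

Lemma sqnorm_slice x : sqnorm x = \sum_j sqnorm (slice x j).
Proof.
rewrite /sqnorm sum_mxtens exchange_big; apply: eq_bigr => j _.
by apply: eq_bigr => i _; rewrite mxE.
Qed.

Lemma dot_stack (u : 'I_m -> 'cV[R]_n) x :
  dot (stack u) x = \sum_i dot (u i) (block x i).
Proof.
rewrite /dot sum_mxtens; apply: eq_bigr => i _.
by apply: eq_bigr => j _; rewrite stackE mxE.
Qed.

Lemma lift_mxE (W : 'M[R]_m) x i j :
  (lift_mx n W *m x) (mxtens_index (i, j)) 0 =
  \sum_k W i k * x (mxtens_index (k, j)) 0.
Proof.
rewrite mxE sum_mxtens; apply: eq_bigr => k _.
rewrite (bigD1 j)//= big1 ?addr0.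
  by rewrite tensmxE mxE eqxx mulr1.
by move=> l lj; rewrite tensmxE mxE eq_sym (negbTE lj) mulr0 mul0r.
Qed.

Lemma dot_lift_mx (W : 'M[R]_m) x y :
  dot x (lift_mx n W *m y) = \sum_j dot (slice x j) (W *m slice y j).
Proof.
rewrite /dot sum_mxtens exchange_big; apply: eq_bigr => j _.
apply: eq_bigr => i _; rewrite lift_mxE !mxE; congr (_ * _).
by apply: eq_bigr => k _; rewrite mxE.
Qed.

End Stacking.

Section MixingMatrix.
Context {R : realType} {N : nat}.
Variables (W : 'M[R]_N).

Lemma dot_mulmx_sym : W^T = W -> forall u v, dot u (W *m v) = dot v (W *m u).
Proof.
move=> Wsym u v; rewrite /dot.
under eq_bigr do rewrite mxE mulr_sumr.
under [RHS]eq_bigr do rewrite mxE mulr_sumr.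
rewrite exchange_big; apply: eq_bigr => k _; apply: eq_bigr => i _ /=.
by rewrite -[in LHS]Wsym mxE; ring.
Qed.

(** Each product [u_i u_j] is at most the mean of the two squares; unit row and column sums add
    these weighted means up to [sqnorm u]. *)
Lemma doubly_stochastic_le : doubly_stochastic W ->
  forall u : 'cV[R]_N, dot u (W *m u) <= sqnorm u.
Proof.
case=> W0 Wr Wc u; rewrite /dot.
have -> : sqnorm u = \sum_i \sum_j W i j * (u i 0 ^+ 2 / 2 + u j 0 ^+ 2 / 2).
  under [RHS]eq_bigr do under eq_bigr do rewrite mulrDr.
  under [RHS]eq_bigr do rewrite big_split/= -mulr_suml Wr mul1r.
  rewrite big_split/= exchange_big/=.
  under [X in _ = _ + X]eq_bigr do rewrite -mulr_suml Wc mul1r.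
  by rewrite -big_split; apply: eq_bigr => i _ /=; rewrite -splitr.
apply: ler_sum => i _; rewrite mxE mulr_sumr; apply: ler_sum => j _.
rewrite mulrCA ler_wpM2l//.
by have := sqr_ge0 (u i 0 - u j 0); nra.
Qed.

Lemma last_eigenvalue_le (lam : N.-tuple R) a : eigenvalues W lam ->
  a \in lam -> lam`_N.-1 <= a.
Proof.
move=> [_ slam] /(nthP 0)[i il <-].
rewrite size_tuple in il.
have N0 : (0 < N)%N by exact: leq_ltn_trans il.
have := @sorted_leq_nth _ (>=%R : rel R) ge_trans (@lexx _ _) 0 lam slam i N.-1.
rewrite !inE size_tuple ltn_predL N0; apply => //.
by rewrite -ltnS prednK.
Qed.

Lemma mixing_matrix_ge (lam : N.-tuple R) : W^T = W -> eigenvalues W lam ->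
  forall u : 'cV[R]_N, lam`_N.-1 * sqnorm u <= dot u (W *m u).
Proof.
move=> Wsym elam; apply: (symmetric_quadratic_ge Wsym (proj1 elam)) => a.
exact: last_eigenvalue_le.
Qed.

(** Compares the lower and the upper bound on the quadratic form at the all-ones vector. *)
Lemma last_eigenvalue_le1 (lam : N.-tuple R) : (0 < N)%N -> W^T = W ->
  doubly_stochastic W -> eigenvalues W lam -> lam`_N.-1 <= 1.
Proof.
move=> N0 Wsym dW elam.
have h := le_trans (mixing_matrix_ge Wsym elam (const_mx 1)) (doubly_stochastic_le dW _).
have s1 : sqnorm (const_mx 1 : 'cV[R]_N) = N%:R.
  rewrite /sqnorm; under eq_bigr do rewrite mxE expr1n.
  by rewrite sumr_const card_ord.
by move: h; rewrite s1 ger_pMl// ltr0n.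
Qed.

End MixingMatrix.

Section Penalized.
Context {R : realType} {N d : nat}.
Variables (f : 'I_N -> 'cV[R]_d -> R) (W : 'M[R]_N) (alpha : R).
Hypotheses (alpha_gt0 : 0 < alpha) (Wsym : W^T = W).

Definition gradient_objective (y : 'cV[R]_(N * d)) : 'cV[R]_(N * d) :=
  stack (fun i => gradient (f i) (block y i)).

(** Explicit gradient of [penalized] for symmetric [W], as the first-order term of
    [penalized_expand] confirms. *)
Definition gradient_penalized (y : 'cV[R]_(N * d)) : 'cV[R]_(N * d) :=
  alpha^-1 *: (y - lift_mx d W *m y) + gradient_objective y.

(** An exact expansion: the quadratic penalty contributes its own second-order term and each [f i]
    its Bregman remainder. The lower and upper bounds below estimate these two remainders
    separately. *)
Lemma penalized_expand (y z : 'cV[R]_(N * d)) :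
  penalized f W alpha z - penalized f W alpha y =
  dot (gradient_penalized y) (z - y)
  + (2 * alpha)^-1 * (sqnorm (z - y) - dot (z - y) (lift_mx d W *m (z - y)))
  + \sum_i (f i (block z i) - (f i (block y i)
            + dot (gradient (f i) (block y i)) (block z i - block y i))).
Proof.
have liftC u v : dot u (lift_mx d W *m v) = dot v (lift_mx d W *m u).
  by rewrite !dot_lift_mx; apply: eq_bigr => j _; exact: dot_mulmx_sym.
rewrite /penalized /objective -!mulmxA !dotE !mulmxBl !mul1mx.
rewrite /gradient_penalized /gradient_objective [dot (_ *: _ + _) _]dotDl dotZl dot_stack.
under [X in _ = _ + X]eq_bigr do rewrite -blockB.
rewrite sumrB big_split/=.
rewrite -dotxx mulmxBr !(dotDl, dotDr, dotNl, dotNr) (liftC z y) (dotC z y).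
rewrite (dotC (lift_mx d W *m y) y) (dotC (lift_mx d W *m y) z) (liftC z y).
by field; rewrite gt_eqF.
Qed.

Lemma penalized_lower (mu : R) : doubly_stochastic W ->
  (forall i, strongly_convex mu (f i)) -> (forall i x, differentiable (f i) x) ->
  forall y z, penalized f W alpha y + dot (gradient_penalized y) (z - y)
    + mu / 2 * sqnorm (z - y) <= penalized f W alpha z.
Proof.
move=> dW sc df y z; rewrite -subr_ge0.
have := penalized_expand y z.
set A := dot (gradient_penalized y) _; set B := \sum_i _; set C := _ * (_ - _) => E.
(* The penalty is convex since [W] is at most the identity as a quadratic form; the modulus [mu]
   comes from the [f i] alone. *)
have C0 : 0 <= C.
  rewrite mulr_ge0 ?invr_ge0 ?mulr_ge0 ?(ltW alpha_gt0)// subr_ge0.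
  by rewrite dot_lift_mx sqnorm_slice ler_sum// => j _; exact: doubly_stochastic_le.
have : mu / 2 * sqnorm (z - y) <= B.
  rewrite sqnorm_block mulr_sumr; apply: ler_sum => i _; rewrite blockB.
  by have := strongly_convex_lower (block z i) (sc i) (df i (block y i)); lra.
by lra.
Qed.

Lemma penalized_upper (L : R) (lam : N.-tuple R) : 0 < L -> eigenvalues W lam ->
  (forall i, lipschitz_gradient L (f i)) ->
  forall y z, penalized f W alpha z <= penalized f W alpha y
    + dot (gradient_penalized y) (z - y)
    + ((1 - lam`_N.-1) / alpha + L) / 2 * sqnorm (z - y).
Proof.
move=> L0 elam lip y z; rewrite -subr_ge0.
have := penalized_expand y z.
set A := dot (gradient_penalized y) _; set B := \sum_i _; set C := _ * (_ - _) => E.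
(* The largest eigenvalue of [1 - W] is one minus the smallest of [W], which yields the first part
   of the smoothness constant. *)
have C0 : C <= (1 - lam`_N.-1) / alpha / 2 * sqnorm (z - y).
  rewrite [leRHS](_ : _ = (2 * alpha)^-1 * (sqnorm (z - y) - lam`_N.-1 * sqnorm (z - y))); last first.
    by field; rewrite gt_eqF.
  rewrite ler_wpM2l ?invr_ge0 ?mulr_ge0 ?(ltW alpha_gt0)// lerB//.
  rewrite dot_lift_mx sqnorm_slice mulr_sumr ler_sum// => j _.
  exact: mixing_matrix_ge.
have : B <= L / 2 * sqnorm (z - y).
  rewrite sqnorm_block mulr_sumr; apply: ler_sum => i _; rewrite blockB.
  by have := descent_lemma (block y i) (block z i) L0 (lip i); lra.
by lra.
Qed.

Lemma lyapunovE (mu : R) (xinf x x' : 'cV[R]_(N * d)) : 0 <= mu ->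
  lyapunov f W alpha mu xinf
    (stack (fun i : 'I_2 => if i == 0 then x - xinf else x' - xinf)) =
  energy (penalized f W alpha) mu alpha xinf x x'.
Proof.
move=> mu0; rewrite /lyapunov /energy -addrA.
set xi := stack _.
have xi0 j : xi (mxtens_index (0, j)) 0 = (x - xinf) j 0 by rewrite stackE.
have xi1 j : xi (mxtens_index (1, j)) 0 = (x' - xinf) j 0 by rewrite stackE.
clearbody xi.
congr (_ + (penalized f W alpha _ - _)); last first.
  apply/colP => k; rewrite mxE.
  suff -> : (lyap_T *m xi) k 0 = (x - xinf) k 0 by rewrite !mxE subrK.
  (* [lyap_T] is [(1, 0)] tensored with the identity: block 1 contributes nothing, and block 0 only
     its entry [k]. *)
  rewrite mxE sum_mxtens big_ord_recl [X in _ + X]big1 ?addr0 => [|b _]; last first.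
    by apply: big1 => l _; rewrite castmxE !mxE [cast_ord _ (mxtens_index _)]cast_ord_id !mxtens_indexK/= !mul0r.
  have unk : (mxtens_unindex (cast_ord (esym (mul1n (N * d))) k)).2 = k.
    by apply: val_inj => /=; rewrite modn_small.
  rewrite (bigD1 k)//= big1 ?addr0 => [|l lk].
    by rewrite castmxE !mxE unk [cast_ord _ (mxtens_index _)]cast_ord_id mxtens_indexK/= eqxx !mul1r xi0 !mxE.
  by rewrite castmxE !mxE unk [cast_ord _ (mxtens_index _)]cast_ord_id mxtens_indexK/= eq_sym (negbTE lk) mulr0 mul0r.
rewrite -mulmxA dotE -/(lift_mx (N * d) _) dot_lift_mx /sqnorm mulr_sumr.
apply: eq_bigr => j _.
rewrite -mulmxA -dotE mulmxA mxE big_ord1.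
rewrite !mxE !big_ord_recl !big_ord0 !mxE/= !addr0.
have -> : lift ord0 ord0 = 1 :> 'I_2 by apply: val_inj.
rewrite xi0 xi1 !mxE.
set v0 := (Num.sqrt (2 * alpha))^-1.
(* Hence the second entry of [lyap_v] is [-(1 - rho)] times the first, which produces the square in
   [energy]. *)
have -> : Num.sqrt (mu / 2) = Num.sqrt (alpha * mu) * v0.
  have am0 : 0 <= alpha * mu by rewrite mulr_ge0 ?(ltW alpha_gt0).
  rewrite /v0 -sqrtrV ?mulr_ge0 ?(ltW alpha_gt0)// -(sqrtrM _ am0); congr Num.sqrt.
  by field; rewrite gt_eqF.
have -> : Num.sqrt (2 * alpha)^-1 = v0 by rewrite sqrtrV// mulr_ge0 ?(ltW alpha_gt0).
have -> : (2 * alpha)^-1 = v0 ^+ 2 by rewrite exprVn sqr_sqrtr// mulr_ge0 ?(ltW alpha_gt0).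
by ring.
Qed.

End Penalized.

(** * Freezing an independent variable *)

Section IndependentPair.
Context d d1 d2 (T : measurableType d) (T1 : measurableType d1)
  (T2 : measurableType d2) (R : realType) (P : probability T R).
Variables (X : {mfun T >-> T1}) (Y : {mfun T >-> T2}).

Definition mfun_pair_fun t := (X t, Y t).

Lemma measurable_mfun_pair : measurable_fun setT mfun_pair_fun.
Proof. by apply/measurable_fun_pairP; split; exact: measurable_funPT. Qed.

HB.instance Definition _ := isMeasurableFun.Build _ _ _ _ mfun_pair_fun
  measurable_mfun_pair.

Hypothesis XY : forall A B, measurable A -> measurable B ->
  (P (X @^-1` A `&` Y @^-1` B) = P (X @^-1` A) * P (Y @^-1` B))%E.

Lemma distribution_pair C : measurable C ->
  (distribution P X \x distribution P Y)%E C = distribution P mfun_pair_fun C.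
Proof.
apply: product_measure_unique => A B mA mB.
by rewrite /distribution /pushforward/= -XY.
Qed.

(** By independence the law of the pair is the product of the two laws, so Fubini's theorem applies
    to the image integral. *)
Lemma integral_distribution_pair (h : T1 * T2 -> \bar R) :
  measurable_fun setT h -> P.-integrable setT (h \o mfun_pair_fun) ->
  (distribution P X \x distribution P Y)%E.-integrable setT h /\
  (\int[P]_t h (X t, Y t) =
     \int[distribution P X]_x \int[distribution P Y]_y h (x, y))%E.
Proof.
move=> mh ih.
have ih' : (distribution P X \x distribution P Y)%E.-integrable setT h.
  have /integrableP[_ ihoo] : (distribution P mfun_pair_fun).-integrable setT h.
    by apply: integrable_pushforward => //; exact: measurable_funPT.
  apply/integrableP; split => //.
  rewrite (eq_measure_integral (distribution P mfun_pair_fun))// => C mC _.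
  exact: distribution_pair.
split => //.
have := integral12_prod_meas1 ih'; rewrite /fubini_F => ->.
rewrite (eq_measure_integral (distribution P mfun_pair_fun)).
  by rewrite integral_distribution.
by move=> C mC _; exact: distribution_pair.
Qed.

End IndependentPair.

Lemma integral_mkcond_indic d (T : measurableType d) (R : realType)
    (m : {measure set T -> \bar R}) (A : set T) (g : T -> \bar R) :
  (\int[m]_(t in A) g t = \int[m]_t ((\1_A t)%:E * g t))%E.
Proof.
rewrite integral_mkcond; apply: eq_integral => t _; rewrite patchE indicE.
by case: ifPn => tA; rewrite ?mul1e ?mul0e.
Qed.

Section SubSigmaAlgebra.
Context d dE (T : measurableType d) (E : measurableType dE)
  (R : realType) (P : probability T R).
Variables (S : set (set T)) (w : {mfun T >-> E}).
Hypothesis S_sub : <<s S >> `<=` (measurable : set (set T)).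

(** The identity as a random variable into [T] with the coarser sigma-algebra: its law is [P]
    restricted to [<<s S >>], so a whole sub-sigma-algebra can be paired with [w] like a single
    variable. *)
Definition to_sub : T -> g_sigma_algebraType S := fun t => t.

Lemma measurable_to_sub : measurable_fun setT to_sub.
Proof. by move=> _ A mA; rewrite setTI; exact: S_sub. Qed.

Definition to_sub_mfun : {mfun T >-> g_sigma_algebraType S} :=
  HB.pack to_sub (isMeasurableFun.Build _ _ _ _ to_sub measurable_to_sub).

Lemma measurable_fun_sub dU (U : measurableType dU) (X : g_sigma_algebraType S -> U) :
  measurable_fun setT X -> measurable_fun setT (X : T -> U).
Proof. by move=> mX _ A mA; rewrite setTI; apply: S_sub; have := mX measurableT A mA; rewrite setTI. Qed.

Lemma ae_to_sub (Q : T -> Prop) :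
  {ae distribution P to_sub_mfun, forall t, Q t} -> {ae P, forall t, Q t}.
Proof.
by case=> A [mA A0 QA]; exists A; split => //; exact: S_sub.
Qed.

Hypothesis w_indep : forall A B, <<s S >> A -> measurable B ->
  (P (A `&` w @^-1` B) = P A * P (w @^-1` B))%E.

Variable H : T -> E -> R.
Hypothesis mH : measurable_fun setT
  (fun p : g_sigma_algebraType S * E => H p.1 p.2).

(* A version of the conditional expectation of [H t (w t)] given [<<s S >>]. *)
Definition freeze (t : T) : \bar R := (\int[distribution P w]_v (H t v)%:E)%E.

(** Fubini for the product law of [to_sub] and [w]: with [t] frozen, [phi t] is a constant and
    leaves the inner integral. *)
Lemma integral_freeze (phi : g_sigma_algebraType S -> R) :
  measurable_fun setT phi ->
  P.-integrable setT (fun t => (H t (w t))%:E) ->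
  P.-integrable setT (fun t => (phi t * H t (w t))%:E) ->
  (\int[P]_t (phi t * H t (w t))%:E =
   \int[distribution P to_sub_mfun]_t ((phi t)%:E * freeze t))%E.
Proof.
move=> mphi iH iphiH.
have ind (A : set (g_sigma_algebraType S)) B : measurable A -> measurable B ->
    (P (to_sub_mfun @^-1` A `&` w @^-1` B) = P (to_sub_mfun @^-1` A) * P (w @^-1` B))%E.
  exact: w_indep.
have mH' : measurable_fun setT (fun p : g_sigma_algebraType S * E => (H p.1 p.2)%:E).
  exact/measurable_EFinP.
have mphiH : measurable_fun setT
    (fun p : g_sigma_algebraType S * E => (phi p.1 * H p.1 p.2)%:E).
  apply/measurable_EFinP/measurable_funM => //.
  exact: measurableT_comp.
have [i1 _] := integral_distribution_pair ind mH' iH.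
have [i2 ->] := integral_distribution_pair ind mphiH iphiH.
apply: ae_eq_integral => //=.
- exact: (measurable_fubini_F i2).
- apply: emeasurable_funM; first exact/measurable_EFinP.
  exact: (measurable_fubini_F i1).
(* The constant is pulled out where [H t] is integrable, hence for almost every [t]. *)
- apply: filterS (ae_integrable1 i1) => t /= it _.
  by under eq_integral do rewrite EFinM; rewrite integralZl.
Qed.

Lemma measurable_freeze : P.-integrable setT (fun t => (H t (w t))%:E) ->
  measurable_fun setT (freeze : g_sigma_algebraType S -> \bar R).
Proof.
move=> iH.
have ind (A : set (g_sigma_algebraType S)) B : measurable A -> measurable B ->
    (P (to_sub_mfun @^-1` A `&` w @^-1` B) = P (to_sub_mfun @^-1` A) * P (w @^-1` B))%E.
  exact: w_indep.
have mH' : measurable_fun setT (fun p : g_sigma_algebraType S * E => (H p.1 p.2)%:E).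
  exact/measurable_EFinP.
have [i1 _] := integral_distribution_pair ind mH' iH.
exact: (measurable_fubini_F i1).
Qed.

(** Both functions are measurable for [<<s S >>] and have equal integrals over its sets, the second
    by [integral_freeze] with [phi] an indicator. *)
Lemma cond_exp_freeze (Z : T -> R) :
  P.-integrable setT (fun t => (H t (w t))%:E) ->
  measurable_fun setT (Z : g_sigma_algebraType S -> R) ->
  P.-integrable setT (EFin \o Z) ->
  (forall A, <<s S >> A ->
    (\int[P]_(t in A) (Z t)%:E = \int[P]_(t in A) (H t (w t))%:E)%E) ->
  {ae P, forall t, (Z t)%:E = freeze t}.
Proof.
move=> iH mZ iZ ZE; apply: ae_to_sub.
have mZ' : measurable_fun setT (EFin \o (Z : g_sigma_algebraType S -> R)).
  exact/measurable_EFinP.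
have iZ' : (distribution P to_sub_mfun).-integrable setT (EFin \o Z).
  by apply: integrable_pushforward.
suff : ae_eq (distribution P to_sub_mfun) setT (EFin \o Z) freeze.
  by apply: filterS => t; exact.
apply: integral_ae_eq => //; first exact: measurable_freeze.
move=> A _ mA.
transitivity (\int[P]_(t in A) (Z t)%:E)%E.
  rewrite integral_pushforward//.
  by apply: integrableS iZ => //; exact: S_sub.
rewrite ZE// [RHS]integral_mkcond_indic -integral_freeze//.
- rewrite integral_mkcond_indic.
  by apply: eq_integral => t _; rewrite EFinM.
- have /integrable_mkcond : P.-integrable A (fun t => (H t (w t))%:E).
    by apply: integrableS iH => //; exact: S_sub.
  move=> /(_ (S_sub mA)); apply: eq_integrable => // t _.
  by rewrite patchE indicE; case: ifPn => tA; rewrite ?mul1r ?mul0r.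
Qed.

End SubSigmaAlgebra.

Section CondExpTransfer.
Context d dE (T : measurableType d) (E : measurableType dE)
  (R : realType) (P : probability T R).
Variables (S S' : set (set T)) (w : {mfun T >-> E}).
Hypothesis SS' : <<s S >> `<=` <<s S' >>.
Hypothesis S'_sub : <<s S' >> `<=` (measurable : set (set T)).
Hypothesis w_indep : forall A B, <<s S' >> A -> measurable B ->
  (P (A `&` w @^-1` B) = P A * P (w @^-1` B))%E.
Variables (H : T -> E -> R) (Z : T -> R).
Hypothesis mH : measurable_fun setT
  (fun p : g_sigma_algebraType S * E => H p.1 p.2).
Hypothesis cZ : is_cond_exp P <<s S >> (fun t => H t (w t)) Z.

(* As w is independent of S', a conditional mean given the smaller S is also
   a conditional mean given S'. *)
Lemma cond_exp_transfer (phi : g_sigma_algebraType S' -> R) :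
  measurable_fun setT phi ->
  P.-integrable setT (fun t => (phi t * H t (w t))%:E) ->
  P.-integrable setT (fun t => (phi t * Z t)%:E) ->
  (\int[P]_t (phi t * H t (w t))%:E = \int[P]_t (phi t * Z t)%:E)%E.
Proof.
move=> mphi iphiH iphiZ; have [iH iZ mZ ZE] := cZ.
have mH' : measurable_fun setT (fun p : g_sigma_algebraType S' * E => H p.1 p.2).
  pose i (p : g_sigma_algebraType S' * E) : g_sigma_algebraType S * E := p.
  apply: (measurableT_comp mH (g := i)).
  apply/measurable_fun_pairP; split; last exact: measurable_snd.
  move=> _ A mA; rewrite setTI.
  have := @measurable_fst _ _ (g_sigma_algebraType S') E measurableT A (SS' mA).
  by rewrite setTI.
rewrite (integral_freeze (S := S') S'_sub w_indep mH')//.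
have mfr : measurable_fun setT (fun t : g_sigma_algebraType S' => ((phi t)%:E * freeze P w H t)%E).
  apply: emeasurable_funM; first exact/measurable_EFinP.
  exact: (measurable_freeze S'_sub).
(* [freeze] involves only [H] and the law of [w], not a sigma-algebra: it is identified with [Z]
   through [S], while the integral against [phi] was computed through [S']. *)
have ae : {ae P, forall t, (Z t)%:E = freeze P w H t}.
  apply: (cond_exp_freeze (S := S)) => //.
  - exact: subset_trans S'_sub.
  - by move=> A B /SS'; exact: w_indep.
  - by move=> _ B mB; rewrite setTI; exact: mZ.
have mfr' : measurable_fun setT (fun t : T => ((phi t)%:E * freeze P w H t)%E).
  exact: (measurable_fun_sub S'_sub).
have aeE : ae_eq P setT (fun t => ((phi t)%:E * freeze P w H t)%E) (fun t => (phi t * Z t)%:E).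
  by apply: filterS ae => t <- _; rewrite EFinM.
have mphiZ := measurable_int _ iphiZ.
have ifr : P.-integrable setT (fun t : T => ((phi t)%:E * freeze P w H t)%E).
  apply/integrableP; split => //; have /integrableP[_] := iphiZ.
  apply: le_lt_trans; rewrite le_eqVlt; apply/orP; left; apply/eqP.
  apply: ae_eq_integral => //; try exact: measurableT_comp.
  by apply: filterS aeE => t /[apply] ->.
rewrite integral_pushforward//=; last exact: measurable_to_sub.
by rewrite preimage_setT; apply: ae_eq_integral.
Qed.

End CondExpTransfer.

(** * Square-integrable random variables *)

Section SquareIntegrable.
Context d (T : measurableType d) (R : realType) (P : probability T R).
Implicit Types X Y : T -> R.

Definition sqint X : Prop :=
  measurable_fun setT X /\ P.-integrable setT (fun t => (X t ^+ 2)%:E).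

Lemma eq_sqint X Y : sqint X -> X =1 Y -> sqint Y.
Proof. by move=> sX /funext <-. Qed.

Lemma integrable_dominated X Y : measurable_fun setT X ->
  P.-integrable setT (fun t => (Y t)%:E) -> (forall t, `|X t| <= Y t) ->
  P.-integrable setT (fun t => (X t)%:E).
Proof.
move=> mX iY XY; apply: (le_integrable measurableT _ _ iY).
  exact/measurable_EFinP.
by move=> t _; rewrite lee_fin (le_trans (XY t))// ler_norm.
Qed.

Lemma sqint_dominated X Y : measurable_fun setT X ->
  P.-integrable setT (fun t => (Y t)%:E) -> (forall t, X t ^+ 2 <= Y t) -> sqint X.
Proof.
move=> mX iY XY; split => //; apply: integrable_dominated iY _.
  exact: measurable_funX.
by move=> t; rewrite ger0_norm ?sqr_ge0.
Qed.

Lemma integrableRD X Y : P.-integrable setT (fun t => (X t)%:E) ->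
  P.-integrable setT (fun t => (Y t)%:E) ->
  P.-integrable setT (fun t => (X t + Y t)%:E).
Proof. by move=> iX iY; have := integrableD measurableT iX iY. Qed.

Lemma integrableRZ (a : R) X : P.-integrable setT (fun t => (X t)%:E) ->
  P.-integrable setT (fun t => (a * X t)%:E).
Proof. by move=> iX; have := integrableZl measurableT a iX. Qed.

Lemma integrableR_sum (I : Type) (s : seq I) (F : I -> T -> R) :
  (forall i, P.-integrable setT (fun t => (F i t)%:E)) ->
  P.-integrable setT (fun t => (\sum_(i <- s) F i t)%:E).
Proof.
move=> iF; have := integrable_sum measurableT s (P := predT) (fun i _ => iF i).
by apply: eq_integrable => // t _; rewrite sumEFin.
Qed.

Lemma Rintegral_sum (I : Type) (s : seq I) (F : I -> T -> R) :
  (forall i, P.-integrable setT (fun t => (F i t)%:E)) ->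
  \int[P]_t (\sum_(i <- s) F i t) = \sum_(i <- s) \int[P]_t F i t.
Proof.
move=> iF; elim: s => [|i s IH].
  rewrite big_nil (_ : (fun _ => _) = cst 0) ?Rintegral_cst ?mul0r//.
  by apply/funext => t; rewrite big_nil.
rewrite big_cons -IH -RintegralD//; [|exact: iF|exact: integrableR_sum].
by apply: eq_Rintegral => t _; rewrite big_cons.
Qed.

Lemma Rintegral_cst_probability (c : R) : \int[P]_t c = c.
Proof.
rewrite Rintegral_cst// -[RHS]mulr1; congr (_ * _).
exact: (congr1 fine (probability_setT P)).
Qed.

Lemma integrableR_cst (c : R) : P.-integrable setT (fun=> c%:E).
Proof. exact: finite_measure_integrable_cst. Qed.

(** Truncating [Z] at [c] changes it on a null set only and makes the bound hold everywhere. *)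
Lemma ae_le_integral_cst (Z : T -> R) (c : R) :
  P.-integrable setT (EFin \o Z) -> {ae P, forall t, Z t <= c} ->
  (\int[P]_t (Z t)%:E <= c%:E)%E.
Proof.
move=> iZ Zc; have mZ : measurable_fun setT Z.
  exact/measurable_EFinP/(measurable_int _ iZ).
have mM : measurable_fun setT (fun t => Num.min (Z t) c) by exact: measurable_minr.
rewrite (ae_eq_integral (fun t => (Num.min (Z t) c)%:E))//.
- have iM : P.-integrable setT (fun t => (Num.min (Z t) c)%:E).
    apply: (integrable_dominated mM (integrableRD (integrable_norm iZ) (integrableR_cst `|c|))).
    by move=> t /=; case: (leP (Z t) c) => _; rewrite ?lerDl ?lerDr.
  rewrite -[leLHS]fineK ?integrable_fin_num// lee_fin -/(Rintegral P setT _).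
  have : \int[P]_t Num.min (Z t) c <= \int[P]_t c.
    apply: le_Rintegral => //; first exact: integrableR_cst.
    by move=> t _; rewrite ge_min lexx orbT.
  by rewrite Rintegral_cst_probability.
- exact/measurable_EFinP.
- exact/measurable_EFinP.
- by apply: filterS Zc => t Zt _; rewrite /= min_l.
Qed.

Lemma sqint_cst (c : R) : sqint (fun=> c).
Proof. by split; [exact: measurable_cst | exact: integrableR_cst]. Qed.

Lemma sqintM X Y : sqint X -> sqint Y ->
  P.-integrable setT (fun t => (X t * Y t)%:E).
Proof.
move=> [mX iX] [mY iY]; apply: (integrable_dominated _ (integrableRD iX iY)).
  exact: measurable_funM.
move=> t; rewrite normrM.
rewrite -(real_normK (num_real (X t))) -(real_normK (num_real (Y t))).
have := sqr_ge0 (`|X t| - `|Y t|); have := normr_ge0 (X t).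
by have := normr_ge0 (Y t); nra.
Qed.

Lemma sqint_integrable X : sqint X -> P.-integrable setT (fun t => (X t)%:E).
Proof.
move=> sX; have := sqintM sX (sqint_cst 1).
by apply: eq_integrable => // t _; rewrite mulr1.
Qed.

Lemma sqint_lin (a b : R) X Y : sqint X -> sqint Y ->
  sqint (fun t => a * X t + b * Y t).
Proof.
move=> [mX iX] [mY iY].
apply: (sqint_dominated (Y := fun t => 2 * a ^+ 2 * X t ^+ 2 + 2 * b ^+ 2 * Y t ^+ 2)).
- by apply: measurable_funD; apply: measurable_funM.
- by apply: integrableRD; apply: integrableRZ.
- by move=> t; have := sqr_ge0 (a * X t - b * Y t); nra.
Qed.

Lemma sqint_sum (I : Type) (s : seq I) (F : I -> T -> R) :
  (forall i, sqint (F i)) -> sqint (fun t => \sum_(i <- s) F i t).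
Proof.
move=> sF; elim: s => [|i s IH].
  by under eq_fun do rewrite big_nil; exact: sqint_cst.
under eq_fun do rewrite big_cons.
have := sqint_lin 1 1 (sF i) IH.
by under eq_fun do rewrite !mul1r.
Qed.

(** In each coordinate the second moment about [c] exceeds that about the mean [m] by the square of
    [m - c]. *)
Lemma vector_var_le n (X : T -> 'cV[R]_n) (c : 'cV[R]_n) :
  (forall j, sqint (fun t => X t j 0)) ->
  (vector_var P X <= 'E_P[fun t => sqnorm (X t - c)%R])%E.
Proof.
move=> sX.
set m := vector_mean P X.
have sXc (z : 'cV[R]_n) j : sqint (fun t => (X t - z) j 0).
  have := sqint_lin 1 (- z j 0) (sX j) (sqint_cst 1).
  by under eq_fun do rewrite mul1r mulr1; under [X in _ -> sqint X]eq_fun do rewrite !mxE.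
have isq z j : P.-integrable setT (fun t => (((X t - z) j 0) ^+ 2)%:E) := (sXc z j).2.
have isn z : P.-integrable setT (fun t => (sqnorm (X t - z))%:E).
  by rewrite /sqnorm; apply: integrableR_sum => j; exact: isq.
rewrite /vector_var unlock -/m.
rewrite -[leLHS]fineK ?integrable_fin_num// -[leRHS]fineK ?integrable_fin_num//.
rewrite lee_fin -/(Rintegral P setT _) -/(Rintegral P setT _).
rewrite /sqnorm !Rintegral_sum//; apply: ler_sum => j _.
have mE : m j 0 = \int[P]_t X t j 0 by rewrite mxE unlock.
have iX := sqint_integrable (sX j).
have -> : \int[P]_t (X t - c) j 0 ^+ 2 = \int[P]_t ((X t - m) j 0 ^+ 2 +
    (2 * (m j 0 - c j 0) * X t j 0 + (c j 0 ^+ 2 - m j 0 ^+ 2))).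
  by apply: eq_Rintegral => t _; rewrite !mxE; ring.
rewrite RintegralD//; [|exact: isq|]; last first.
  by apply: integrableRD; [exact: integrableRZ | exact: integrableR_cst].
rewrite RintegralD//; [|exact: integrableRZ|exact: integrableR_cst].
rewrite RintegralZl// -mE Rintegral_cst_probability.
by have := sqr_ge0 (m j 0 - c j 0); lra.
Qed.

End SquareIntegrable.

(** * Iterating a contraction with random increments *)

Section MeanRecursion.
Context d (T : measurableType d) (R : realType) (P : probability T R).

(* The V k need not be measurable, hence the integrable majorant. *)
Lemma mean_recursion (V a : nat -> T -> R) (q c v0 : R) : 0 <= q ->
  (forall t, V 0%N t <= v0) ->
  (forall k t, V k.+1 t <= q * V k t + a k t) ->
  (forall k, P.-integrable setT (fun t => (a k t)%:E)) ->
  (forall k, \int[P]_t a k t <= (1 - q) * c) -> 0 <= c ->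
  forall k, exists B : T -> R, [/\ P.-integrable setT (fun t => (B t)%:E),
    forall t, V k t <= B t & \int[P]_t B t <= q ^+ k * v0 + c].
Proof.
move=> q0 V0 VS ia a_le c0; elim=> [|k [B [iB VB Bk]]].
  exists (fun=> v0); split => //; first exact: integrableR_cst.
  by rewrite Rintegral_cst_probability expr0 mul1r lerDl.
exists (fun t => q * B t + a k t); split.
- by apply: integrableRD => //; exact: integrableRZ.
- by move=> t; rewrite (le_trans (VS k t))// lerD2r ler_wpM2l.
(* [c] is the fixed point of [s] mapped to [q s + (1 - q) c], so the bound reproduces itself. *)
- rewrite RintegralD//; [|exact: integrableRZ|exact: ia].
  rewrite RintegralZl// exprS -mulrA.
  have := a_le k; have := ler_wpM2l q0 Bk; lra.
Qed.

End MeanRecursion.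

(** * Measurability of the iterates in the past samples *)

Section GeneratedSigmaAlgebra.
Context (I : Type) d dE (T : measurableType d) (E : measurableType dE).
Variables (D : set I) (X : I -> T -> E).

Definition generators : set (set T) :=
  \bigcup_(i in D) preimage_set_system setT (X i) measurable.

Lemma measurable_generators i : D i ->
  measurable_fun setT (X i : g_sigma_algebraType generators -> E).
Proof.
by move=> Di _ B mB; apply: sub_sigma_algebra; exists i => //; exists B.
Qed.

Lemma sigma_of_sub (F : set (set T)) : sigma_algebra setT F ->
  (forall i B, D i -> measurable B -> F (X i @^-1` B)) -> sigma_of D X `<=` F.
Proof.
move=> sF XF; apply: smallest_sub => // A [i Di [B mB <-]].
by rewrite setTI; exact: XF.
Qed.

End GeneratedSigmaAlgebra.

Section MeasurableIterates.
Context {R : realType} {N d : nat} {dE : measure_display} {E : measurableType dE}.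
Context {dU : measure_display} {U : measurableType dU}.

Lemma measurable_oracle n (g : 'cV[R]_n -> E -> 'cV[R]_n)
    (Y : U -> 'cV[R]_n) (v : U -> E) : jointly_measurable g ->
  (forall j, measurable_fun setT (fun u => Y u j 0)) -> measurable_fun setT v ->
  forall j, measurable_fun setT (fun u => g (Y u) (v u) j 0).
Proof.
move=> mg mY mv j.
pose p u : n.-tuple R * E := ([tuple Y u a 0 | a < n], v u).
have mp : measurable_fun setT p.
  apply: measurable_fun_pair => //; apply/measurable_fun_tnthP => a.
  by apply: eq_measurable_fun (mY a) => u _ /=; rewrite tnth_mktuple.
apply: eq_measurable_fun (measurableT_comp (mg j) mp) => u _ /=.
by congr (g _ _ j 0); apply/colP => a; rewrite mxE tnth_mktuple.
Qed.

Variables (G : 'I_N -> 'cV[R]_d -> E -> 'cV[R]_d) (W : 'M[R]_N).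
Variables (alpha beta : R) (x0 xm1 : 'cV[R]_(N * d)).
Hypothesis mG : forall i, jointly_measurable (G i).

Lemma measurable_extrapolate (x x' : U -> 'cV[R]_(N * d)) :
  (forall c, measurable_fun setT (fun u => x u c 0)) ->
  (forall c, measurable_fun setT (fun u => x' u c 0)) ->
  forall c, measurable_fun setT (fun u => extrapolate beta (x u, x' u) c 0).
Proof.
move=> mx mx' c; under eq_fun do rewrite !mxE/=.
by apply: measurable_funB; apply: measurable_funM.
Qed.

(** Iterate [k] reads only samples of index below [k]. The space [U] is left abstract so that it can
    be [T] with the sigma-algebra of the past. *)
Lemma measurable_dasg (v : 'I_N -> nat -> U -> E) k :
  (forall i l, (l < k)%N -> measurable_fun setT (v i l)) ->
  let s u := dasg G W alpha beta x0 xm1 (fun i l => v i l u) k in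
  (forall c, measurable_fun setT (fun u => (s u).1 c 0)) /\
  (forall c, measurable_fun setT (fun u => (s u).2 c 0)).
Proof.
elim: k => [mv|k IH mv] /=; first by split=> c; exact: measurable_cst.
have [|m1 m2] := IH; first by move=> i l lk; apply: mv; exact: ltnW.
split=> // c; have my := measurable_extrapolate m1 m2.
have -> : c = mxtens_index (mxtens_unindex c) by rewrite mxtens_unindexK.
case: (mxtens_unindex c) => i a.
under eq_fun do rewrite mxE [(- _ : 'cV_(_)) _ _]mxE [(_ *: _ : 'cV_(_)) _ _]mxE lift_mxE stackE.
apply: measurable_funB.
  by apply: measurable_sum => j; apply: measurable_funM => //; exact: my.
apply: measurable_funM => //; apply: measurable_oracle => //.
  by move=> j; under eq_fun do rewrite mxE; exact: my.
exact: mv.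
Qed.

End MeasurableIterates.

(** * The noise along the iterates *)

Section StochasticIterates.
Context {R : realType} {N d : nat}.
Context {disp : measure_display} {T : measurableType disp} {P : probability T R}.
Context {dispE : measure_display} {E : measurableType dispE}.
Variables (f : 'I_N -> 'cV[R]_d -> R) (L : R).
Hypothesis L_ge0 : 0 <= L.
Hypothesis lip : forall i, lipschitz_gradient L (f i).
Variables (W : 'M[R]_N) (alpha beta sigma : R) (x0 xm1 : 'cV[R]_(N * d)).
Variables (w : 'I_N -> nat -> {RV P >-> E}).
Variable G : 'I_N -> 'cV[R]_d -> E -> 'cV[R]_d.
Hypothesis mG : forall i, jointly_measurable (G i).

Let x k t := dasg_x G W alpha beta x0 xm1 (fun i l => w i l t) k.
Let x' k t := (dasg G W alpha beta x0 xm1 (fun i l => w i l t) k).2.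
Let y k t := dasg_y G W alpha beta x0 xm1 (fun i l => w i l t) k.

Hypothesis indep : noise_independent P (fun i k => w i k : T -> E).
Hypothesis unbiased : forall i k, unbiased_oracle P (gradient (f i))
  (fun t => block (y k t) i) (fun t => G i (block (y k t) i) (w i k t)).
Hypothesis bounded : forall i k, bounded_variance_oracle P sigma (gradient (f i))
  (fun t => block (y k t) i) (fun t => G i (block (y k t) i) (w i k t)).

Definition noise k t : 'cV[R]_(N * d) :=
  stoch_grad G (y k t) (fun i => w i k t) - gradient_objective f (y k t).

(** Everything [w i k] is assumed independent of, including the current samples of the other
    nodes. *)
Let past i k := generators
  [set jt : 'I_N * nat | (jt.2 < k)%N \/ (jt.2 = k /\ jt.1 != i)]
  (fun jt => w jt.1 jt.2 : T -> E).

Lemma past_sub i k : <<s past i k >> `<=` (measurable : set (set T)).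
Proof.
apply: sigma_of_sub; first exact: sigma_algebra_measurable.
by move=> jt B _ mB; exact: measurable_funPTI.
Qed.

Lemma past_indep i k A B : <<s past i k >> A -> measurable B ->
  (P (A `&` w i k @^-1` B) = P A * P (w i k @^-1` B))%E.
Proof.
move=> sA mB; rewrite setIC muleC; apply: (indep (i := i) (k := k)) => //.
by rewrite -[_ @^-1` _]setTI; apply: (measurable_generators (D := [set i]) (X := fun j => w j k : T -> E)).
Qed.

Lemma measurable_past i k c :
  [/\ measurable_fun setT (fun t : g_sigma_algebraType (past i k) => x k t c 0),
    measurable_fun setT (fun t : g_sigma_algebraType (past i k) => x' k t c 0)
  & measurable_fun setT (fun t : g_sigma_algebraType (past i k) => y k t c 0)].
Proof.
have mw j l : (l < k)%N ->
    measurable_fun setT (w j l : g_sigma_algebraType (past i k) -> E).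
  move=> lk; apply: (measurable_generators (i := (j, l))
    (X := fun jt : 'I_N * nat => w jt.1 jt.2 : T -> E)).
  by left.
have [m1 m2] := measurable_dasg W alpha beta x0 xm1 mG
  (v := fun j l => w j l : g_sigma_algebraType (past i k) -> E) mw.
by split => //; apply: measurable_extrapolate.
Qed.

(** As a conditional expectation in [unbiased], the gradient is measurable for the sigma-algebra of
    the block, which is contained in any one making the block measurable. *)
Lemma measurable_block_gradient i k a (S : set (set T)) :
  (forall b, measurable_fun setT
    (fun t : g_sigma_algebraType S => block (y k t) i b 0)) ->
  measurable_fun setT (fun t : g_sigma_algebraType S =>
    gradient (f i) (block (y k t) i) a 0).
Proof.
move=> my _ B mB; rewrite setTI; have [_ _ mZ _] := unbiased i k a.
move: (mZ B mB); apply: sigma_of_sub; first exact: sigma_algebra_measurable.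
by move=> b C _ mC; have := my b measurableT C mC; rewrite setTI.
Qed.

Lemma measurable_past_block i j k b : measurable_fun setT
  (fun t : g_sigma_algebraType (past i k) => block (y k t) j b 0).
Proof.
have [_ _ my] := measurable_past i k (mxtens_index (j, b)).
by apply: eq_measurable_fun my => t _; rewrite [RHS]mxE.
Qed.

Lemma measurable_past_gradient i j k a : measurable_fun setT
  (fun t : g_sigma_algebraType (past i k) => gradient (f j) (block (y k t) j) a 0).
Proof. by apply: measurable_block_gradient => b; exact: measurable_past_block. Qed.

Lemma noiseE k t i a : noise k t (mxtens_index (i, a)) 0 =
  G i (block (y k t) i) (w i k t) a 0 - gradient (f i) (block (y k t) i) a 0.
Proof.
rewrite /noise /stoch_grad /gradient_objective mxE stackE mxE.
by rewrite stackE.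
Qed.

Lemma block_noise k t i : block (noise k t) i =
  G i (block (y k t) i) (w i k t) - gradient (f i) (block (y k t) i).
Proof. by apply/colP => a; rewrite [LHS]mxE noiseE [RHS]mxE [X in _ = _ + X]mxE. Qed.

Lemma sqint_noise k c : sqint P (fun t => noise k t c 0).
Proof.
rewrite -(mxtens_unindexK c); case: (mxtens_unindex c) => i a.
have [Z [[iS _ _ _] _]] := bounded i k.
apply: (sqint_dominated _ iS); last first.
  move=> t; rewrite -block_noise.
  have -> : noise k t (mxtens_index (i, a)) 0 = block (noise k t) i a 0 by rewrite [RHS]mxE.
  exact: sqr_coord_le.
under eq_fun do rewrite noiseE.
apply: measurable_funB.
  apply: measurable_oracle => // b.
  exact (measurable_fun_sub (@past_sub i k) (@measurable_past_block i i k b)).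
exact (measurable_fun_sub (@past_sub i k) (@measurable_past_gradient i i k a)).
Qed.

(** A Lipschitz gradient grows at most linearly, here compared with its value at 0. *)
Lemma sqint_gradient i k a : (forall c, sqint P (fun t => y k t c 0)) ->
  sqint P (fun t => gradient (f i) (block (y k t) i) a 0).
Proof.
move=> sy.
apply: (sqint_dominated (Y := fun t => 2 * L ^+ 2 * sqnorm (block (y k t) i)
    + 2 * sqnorm (gradient (f i) 0))).
- exact (measurable_fun_sub (@past_sub i k) (@measurable_past_gradient i i k a)).
- apply: integrableRD; last exact: integrableR_cst.
  apply: integrableRZ; apply: integrableR_sum => b.
  by under eq_fun do rewrite mxE; case: (sy (mxtens_index (i, b))).
move=> t; apply: (le_trans (sqr_coord_le _ _)).
rewrite -[X in sqnorm X](subrK (gradient (f i) 0)).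
apply: (le_trans (sqnormD_le _ _)); rewrite lerD2r -mulrA ler_wpM2l//.
have [_ lf] := lip i; have := lf (block (y k t) i) 0; rewrite subr0 => le1.
rewrite -!sqr_enorm -exprMn ler_sqr// ?nnegrE ?mulr_ge0 ?enorm_ge0//.
Qed.

Lemma sqint_extrapolate k : (forall c, sqint P (fun t => x k t c 0)) ->
  (forall c, sqint P (fun t => x' k t c 0)) ->
  forall c, sqint P (fun t => y k t c 0).
Proof.
move=> sx sx' c; have := sqint_lin (1 + beta) (- beta) (sx c) (sx' c).
rewrite (_ : (fun t => _) = fun t => y k t c 0)//; apply/funext => t.
by rewrite /y /dasg_y /extrapolate !mxE mulNr.
Qed.

(** By induction, the new iterate being a linear combination of entries of [y k], a gradient and the
    noise. Square integrability is what makes the products with the noise integrable later. *)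
Lemma sqint_iterate k c :
  sqint P (fun t => x k t c 0) /\ sqint P (fun t => x' k t c 0).
Proof.
elim: k c => [|k IH] c; first by split; exact: sqint_cst.
have sy := sqint_extrapolate (fun c => proj1 (IH c)) (fun c => proj2 (IH c)).
split; last exact: (proj1 (IH c)).
rewrite -(mxtens_unindexK c); case: (mxtens_unindex c) => i a.
have sWy : sqint P (fun t => (lift_mx d W *m y k t) (mxtens_index (i, a)) 0).
  under eq_fun do rewrite lift_mxE.
  apply: sqint_sum => j; have := sqint_lin (W i j) 0 (sy (mxtens_index (j, a))) (sqint_cst P 0).
  by under eq_fun do rewrite mulr0 addr0.
have sG := sqint_lin 1 1 (sqint_gradient i a sy) (sqint_noise k (mxtens_index (i, a))).
have := sqint_lin 1 (- alpha) sWy sG.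
rewrite (_ : (fun t => _) = fun t => x k.+1 t (mxtens_index (i, a)) 0)//.
apply/funext => t; rewrite noiseE.
rewrite [in RHS]/x /dasg_x /= [RHS]mxE [X in _ = _ + X]mxE [X in _ = _ - X]mxE stackE.
by rewrite -/(dasg_y _ _ _ _ _ _ _ _) -/(y k t); ring.
Qed.

(* The conditional mean of the noise is only prescribed given y_i^(k);
   independence upgrades it to the whole past, on which [phi] may depend. *)
Lemma noise_orthogonal i k a (phi : g_sigma_algebraType (past i k) -> R) :
  measurable_fun setT phi -> sqint P phi ->
  \int[P]_t (phi t * noise k t (mxtens_index (i, a)) 0) = 0.
Proof.
move=> mphi sphi.
have sy := sqint_extrapolate (fun c => proj1 (sqint_iterate k c))
  (fun c => proj2 (sqint_iterate k c)).
have sZ := sqint_gradient i a sy.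
have sG : sqint P (fun t => G i (block (y k t) i) (w i k t) a 0).
  have := sqint_lin 1 1 sZ (sqint_noise k (mxtens_index (i, a))).
  by under eq_fun do rewrite noiseE !mul1r addrC subrK.
have iG := sqintM sphi sG; have iZ := sqintM sphi sZ.
under eq_Rintegral do rewrite noiseE mulrBr.
rewrite RintegralB//; apply/eqP; rewrite subr_eq0; apply/eqP; congr fine.
(* [<<s S >>] is the sigma-algebra of the block in [unbiased]; the transfer goes from it to the
   past. *)
pose S := generators setT (fun (j : 'I_d) (t : T) => block (y k t) i j 0).
have SS' : <<s S >> `<=` <<s past i k >>.
  apply: sigma_of_sub; first exact: smallest_sigma_algebra.
  move=> b B _ mB.
  by have := @measurable_past_block i i k b measurableT B mB; rewrite setTI.
have mH : measurable_fun setT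
    (fun p : g_sigma_algebraType S * E => G i (block (y k p.1) i) p.2 a 0).
  apply: (measurable_oracle (Y := fun p : g_sigma_algebraType S * E => block (y k p.1) i)) => // b.
  apply: (measurableT_comp (f := fun t : g_sigma_algebraType S => block (y k t) i b 0)) => //.
  exact: (measurable_generators (D := setT) (X := fun (j : 'I_d) (t : T) => block (y k t) i j 0)).
exact (@cond_exp_transfer _ _ _ _ _ P S (past i k) (w i k) SS' (@past_sub i k)
  (@past_indep i k) (fun t v => G i (block (y k t) i) v a 0) _ mH (unbiased i k a)
  phi mphi iG iZ).
Qed.

Lemma noise_variance k : P.-integrable setT (fun t => (sqnorm (noise k t))%:E) /\
  \int[P]_t sqnorm (noise k t) <= N%:R * sigma ^+ 2.
Proof.
have ib i : P.-integrable setT (fun t => (sqnorm (block (noise k t) i))%:E) /\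
    \int[P]_t sqnorm (block (noise k t) i) <= sigma ^+ 2.
  have [Z [[iS iZ _ ZE] Zle]] := bounded i k.
  have bE : (fun t => sqnorm (block (noise k t) i)) =
      (fun t => sqnorm (G i (block (y k t) i) (w i k t) - gradient (f i) (block (y k t) i))).
    by apply/funext => t; rewrite block_noise.
  split; first by under eq_fun do rewrite block_noise.
  (* The conditional variance integrates over the whole space to the variance itself. *)
  rewrite bE /Rintegral -ZE; last exact: (@measurableT _ (g_sigma_algebraType _)).
  rewrite -lee_fin fineK ?integrable_fin_num//.
  exact: ae_le_integral_cst.
under eq_fun do rewrite sqnorm_block.
under eq_Rintegral do rewrite sqnorm_block.
split; first by apply: integrableR_sum => i; case: (ib i).
rewrite Rintegral_sum; last by move=> i; case: (ib i).
rewrite mulr_natl -[X in _ *+ X]card_ord -sumr_const.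
by apply: ler_sum => i _; case: (ib i).
Qed.

(** Orthogonality is applied coordinatewise; each coordinate belongs to some node [i] and uses that
    node's past, hence measurability for every [i]. *)
Lemma dot_noise k (u : T -> 'cV[R]_(N * d)) :
  (forall i c, measurable_fun setT
    (fun t : g_sigma_algebraType (past i k) => u t c 0)) ->
  (forall c, sqint P (fun t => u t c 0)) ->
  P.-integrable setT (fun t => (dot (u t) (noise k t))%:E) /\
  \int[P]_t dot (u t) (noise k t) = 0.
Proof.
move=> mu su.
have iu c : P.-integrable setT (fun t => (u t c 0 * noise k t c 0)%:E).
  exact: sqintM (su c) (sqint_noise k c).
split; first exact: integrableR_sum iu.
rewrite Rintegral_sum; last exact: iu.
rewrite big1 // => c _; rewrite -(mxtens_unindexK c).
case: (mxtens_unindex c) => i a; exact: noise_orthogonal.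
Qed.

Lemma iterate_step k t : alpha != 0 ->
  x k.+1 t = y k t - alpha *: (gradient_penalized f W alpha (y k t) + noise k t).
Proof.
move=> a0.
have -> : x k.+1 t = lift_mx d W *m y k t
  - alpha *: stoch_grad G (y k t) (fun i => w i k t) by [].
rewrite /gradient_penalized /noise.
move: (lift_mx d W *m y k t) (stoch_grad _ _ _) (gradient_objective f (y k t)) => u v z.
by apply/colP => c; move: (y k t) => yk; rewrite !mxE; field.
Qed.

Lemma cross_noise k (mu Lam : R) (xs : 'cV[R]_(N * d)) :
  let u t := cross (gradient_penalized f W alpha) mu Lam alpha xs (x k t) (y k t) in
  P.-integrable setT (fun t => (dot (u t) (noise k t))%:E) /\
  \int[P]_t dot (u t) (noise k t) = 0.
Proof.
move=> u.
have sy := sqint_extrapolate (fun c => proj1 (sqint_iterate k c))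
  (fun c => proj2 (sqint_iterate k c)).
pose rho := Num.sqrt (alpha * mu).
(* Written out, [cross] is an affine combination of entries of [x k], [y k] and a gradient, so
   measurability in the past and square integrability follow termwise. *)
have uE t i a : u t (mxtens_index (i, a)) 0 =
    Lam * alpha ^+ 2 * (alpha^-1 * (y k t (mxtens_index (i, a)) 0
      - \sum_j W i j * y k t (mxtens_index (j, a)) 0)
      + gradient (f i) (block (y k t) i) a 0)
    - (y k t (mxtens_index (i, a)) 0 - (1 - rho) * x k t (mxtens_index (i, a)) 0
       - rho * xs (mxtens_index (i, a)) 0).
  rewrite -lift_mxE -(stackE (fun i => gradient (f i) (block (y k t) i))).
  rewrite /u /cross /gradient_penalized /gradient_objective.
  move: (lift_mx d W *m y k t) (stack _) => z1 z2; move: (y k t) (x k t) => z3 z4.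
  by rewrite !mxE.
have idxP (Q : 'I_(N * d) -> Prop) : (forall i a, Q (mxtens_index (i, a))) -> forall c, Q c.
  by move=> h c; rewrite -(mxtens_unindexK c); case: (mxtens_unindex c).
apply: dot_noise => [i'|]; apply: idxP => i a.
- have [mx _ _] := measurable_past i' k (mxtens_index (i, a)).
  under eq_fun do rewrite uE.
  have my b : measurable_fun setT (fun t : g_sigma_algebraType (past i' k) => y k t b 0).
    by have [] := measurable_past i' k b.
  do ?[apply: measurable_funB|apply: measurable_funD|apply: measurable_funM|apply: measurable_sum => ?] => //.
  exact: measurable_past_gradient.
- under eq_fun do rewrite uE.
  set c' := mxtens_index (i, a).
  have sS : sqint P (fun t => \sum_j W i j * y k t (mxtens_index (j, a)) 0).
    apply: sqint_sum => j; have := sqint_lin (W i j) 0 (sy (mxtens_index (j, a))) (sqint_cst P 0).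
    by under eq_fun do rewrite mulr0 addr0.
  have s1 := sqint_lin (Lam * alpha ^+ 2 / alpha) (- (Lam * alpha ^+ 2 / alpha)) (sy c') sS.
  have s2 := sqint_lin 1 (Lam * alpha ^+ 2) s1 (sqint_gradient i a sy).
  have s3 := sqint_lin (- 1) (1 - rho) (sy c') (proj1 (sqint_iterate k c')).
  have s4 := sqint_lin 1 rho s3 (sqint_cst P (xs c' 0)).
  by apply: (eq_sqint (sqint_lin 1 1 s2 s4)) => t; ring.
Qed.

End StochasticIterates.

(** * Convergence in mean square *)

(** Based at [u] on the segment from [xs] to [z], the lower bounds at [z] and [xs] with weights [t]
    and [1 - t] cancel the gradient term. Minimality of [xs] at [u] then gives the claim up to a
    factor [1 - t]. *)
Lemma minimizer_growth (R : realType) n (Phi : 'cV[R]_n -> R)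
    (g : 'cV[R]_n -> 'cV[R]_n) (mu : R) (xs : 'cV[R]_n) : 0 < mu ->
  (forall y z, Phi y + dot (g y) (z - y) + mu / 2 * sqnorm (z - y) <= Phi z) ->
  (forall z, Phi xs <= Phi z) ->
  forall z, mu / 2 * sqnorm (z - xs) <= Phi z - Phi xs.
Proof.
move=> mu0 lower xmin z; set c := mu / 2 * _; set D := _ - _.
have D0 : 0 <= D by rewrite subr_ge0.
have segment t : 0 < t < 1 -> (1 - t) * c <= D.
  move=> /andP[t0 t1]; set u := xs + t *: (z - xs).
  have zu : z - u = (1 - t) *: (z - xs).
    by apply/colP => i; rewrite !mxE; ring.
  have su : xs - u = (- t) *: (z - xs).
    by apply/colP => i; rewrite !mxE; ring.
  have := lower u z; have := lower u xs; have := xmin u.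
  rewrite zu su !dotZr !sqnormZ => h1 h2 h3.
  rewrite -(ler_pM2l t0).
  have h4 := ler_wpM2l (ltW t0) h3.
  have t1' : 0 <= 1 - t by lra.
  have h5 := ler_wpM2l t1' h2.
  by rewrite /c /D; nra.
rewrite leNgt; apply/negP => Dc.
have c0 : 0 < c by exact: le_lt_trans Dc.
(* For this [t], [(1 - t) * c] is the midpoint of [c] and [D], which exceeds [D]. *)
have tb : 0 < (c - D) / (2 * c) < 1.
  apply/andP; split; first by apply: divr_gt0; lra.
  by rewrite ltr_pdivrMr; lra.
have := segment _ tb.
have -> : (1 - (c - D) / (2 * c)) * c = c - (c - D) / 2 by field; rewrite gt_eqF.
by lra.
Qed.

(** The upper limit is at most the supremum of a tail, and on a late tail [b] stays below
    [l + e]. *)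
Lemma limn_esup_le_lim (R : realType) (u : nat -> \bar R) (b : nat -> R) (l : R) :
  (forall k, (u k <= (b k)%:E)%E) -> b @ \oo --> l -> (limn_esup u <= l%:E)%E.
Proof.
move=> ub bl; apply/lee_addgt0Pr => e e0.
have /cvgrPdist_le/(_ e e0) [n _ bn] := bl.
apply: (@le_trans _ _ (ereal_sup (u @` [set k | (n <= k)%N]))).
  by apply: ereal_inf_lbound; exists [set k | (n <= k)%N] => //; exists n.
apply: ge_ereal_sup => _ [k nk <-]; rewrite (le_trans (ub k))// -EFinD lee_fin.
by have := bn k nk; rewrite ler_distl => /andP[]; lra.
Qed.

Theorem theorem7 (R : realType) (N d : nat) (hN : (0 < N)%N)
  (mu L : R) (hmu : 0 < mu) (hmuL : mu <= L)
  (f : 'I_N -> 'cV[R]_d -> R)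
  (hconv : forall i, strongly_convex mu (f i))
  (hlip : forall i, lipschitz_gradient L (f i))
  (e : rel 'I_N) (he : connected_graph e)
  (W : 'M[R]_N) (hW : mixing_matrix e W)
  (lam : N.-tuple R) (hlam : eigenvalues W lam)
  (hlamN : 0 < lam`_N.-1)
  (alpha beta : R) (halpha : 0 < alpha <= lam`_N.-1 / L)
  (hbeta : beta = (1 - Num.sqrt (alpha * mu)) / (1 + Num.sqrt (alpha * mu)))
  (disp : measure_display) (T : measurableType disp) (P : probability T R)
  (dispE : measure_display) (E : measurableType dispE)
  (w : 'I_N -> nat -> {RV P >-> E})
  (G : 'I_N -> 'cV[R]_d -> E -> 'cV[R]_d)
  (hG : forall i, jointly_measurable (G i))
  (x0 xm1 : 'cV[R]_(N * d)) (sigma : R) (hsigma : 0 <= sigma)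
  (xinf : 'cV[R]_(N * d))
  (hxinf : forall z : 'cV[R]_(N * d), z != xinf ->
     penalized f W alpha xinf < penalized f W alpha z) :
  let x (k : nat) (t : T) : 'cV[R]_(N * d) :=
    dasg_x G W alpha beta x0 xm1 (fun i l => w i l t) k in
  let y (k : nat) (t : T) : 'cV[R]_(N * d) :=
    dasg_y G W alpha beta x0 xm1 (fun i l => w i l t) k in
  let xi0 : 'cV[R]_(2 * (N * d)) :=
    stack (fun i : 'I_2 => if i == 0 then x0 - xinf else xm1 - xinf) in
  noise_independent P (fun i k => w i k : T -> E) ->
  (forall i k, unbiased_oracle P (gradient (f i))
     (fun t => block (y k t) i)
     (fun t => G i (block (y k t) i) (w i k t))) ->
  (forall i k, bounded_variance_oracle P sigma (gradient (f i))
     (fun t => block (y k t) i)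
     (fun t => G i (block (y k t) i) (w i k t))) ->
  (forall k : nat,
     ('E_P[fun t => sqnorm (x k t - xinf)%R] <=
      (2 * (1 - Num.sqrt (alpha * mu)) ^+ k *
         (lyapunov f W alpha mu xinf xi0 / mu) +
       sigma ^+ 2 * N%:R * Num.sqrt alpha / (mu * Num.sqrt mu) *
         (2 - lam`_N.-1 + alpha * L))%:E)%E) /\
  (0 < sigma ->
     (J_infty P sigma x <=
      (Num.sqrt alpha / (mu * Num.sqrt mu) *
         (2 - lam`_N.-1 + alpha * L))%:E)%E).
Proof.
move=> x y xi0 indep unbiased bounded.
have L0 : 0 < L := lt_le_trans hmu hmuL.
have [a0 aL] := andP halpha.
have [Wsym Wds _ _] := hW.
set lN := lam`_N.-1 in hlamN halpha aL *.
have lN1 : lN <= 1 := last_eigenvalue_le1 hN Wsym Wds hlam.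
set rho := Num.sqrt (alpha * mu).
have aLl : alpha * L <= lN by rewrite -ler_pdivlMr.
have am1 : alpha * mu <= 1.
  by rewrite (le_trans _ lN1)// (le_trans _ aLl)// ler_pM2l.
have rho0 : 0 < rho by rewrite sqrtr_gt0 mulr_gt0.
have rho1 : rho <= 1 by rewrite -sqrtr1 ler_wsqrtr.
set Phi := penalized f W alpha; set g := gradient_penalized f W alpha.
set Lam := (1 - lN) / alpha + L.
(* This turns the factor [1 + alpha * Lam] of the energy step into the [2 - lN + alpha * L] of the
   statement. *)
have aLam : alpha * Lam = 1 - lN + alpha * L.
  by rewrite /Lam mulrDr mulrCA divff ?gt_eqF// mulr1.
have lower := penalized_lower a0 Wsym Wds hconv (fun i => proj1 (hlip i)).
have upper := penalized_upper a0 Wsym L0 hlam hlip.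
have xmin z : Phi xinf <= Phi z.
  by have [->//|/hxinf/ltW] := eqVneq z xinf.
pose x' k t := (dasg G W alpha beta x0 xm1 (fun i l => w i l t) k).2.
pose nz := noise (P := P) f W alpha beta x0 xm1 w G.
pose a k t := dot (cross g mu Lam alpha xinf (x k t) (y k t)) (nz k t)
  + alpha / 2 * (1 + alpha * Lam) * sqnorm (nz k t).
pose V k t := energy Phi mu alpha xinf (x k t) (x' k t).
have stepV k t : V k.+1 t <= (1 - rho) * V k t + a k t.
  rewrite /V /x (iterate_step f) ?gt_eqF//.
  have aLam1 : alpha * Lam <= 1 by rewrite aLam; lra.
  rewrite /a [leRHS]addrA.
  have yE : y k t = (1 + beta) *: x k t - beta *: x' k t by [].
  exact (energy_step xinf hmu a0 aLam1 rho1 lower upper (nz k t) hbeta yE).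
have cr k := cross_noise (ltW L0) hlip hG indep unbiased bounded k mu Lam xinf.
have nv k := noise_variance bounded k.
have sx k c := proj1 (sqint_iterate (ltW L0) hlip hG unbiased bounded k c).
(* Bounds the mean of each increment [a k]. As the contraction factor is [1 - rho], the accumulated
   noise level is [C / rho]. *)
set C := alpha / 2 * (1 + alpha * Lam) * (N%:R * sigma ^+ 2).
have C0 : 0 <= C.
  have aL0 : 0 < alpha * L by rewrite mulr_gt0.
  apply: mulr_ge0; last by apply: mulr_ge0; rewrite ?sqr_ge0.
  apply: mulr_ge0; first by apply: divr_ge0; rewrite ?ltW.
  by rewrite aLam; lra.
have ia k : P.-integrable setT (fun t => (a k t)%:E).
  by apply: integrableRD; [exact: (cr k).1 | apply: integrableRZ; exact: (nv k).1].
have Ea k : \int[P]_t a k t <= (1 - (1 - rho)) * (C / rho).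
  rewrite subKr mulrC divfK ?gt_eqF//.
  rewrite RintegralD//; [|exact: (cr k).1|apply: integrableRZ; exact: (nv k).1].
  rewrite (cr k).2 add0r RintegralZl//; last exact: (nv k).1.
  apply: ler_wpM2l (nv k).2.
  apply: mulr_ge0; first by apply: divr_ge0; rewrite ?ltW.
  by rewrite aLam; have : 0 < alpha * L; [rewrite mulr_gt0 | lra].
have main k : P.-integrable setT (fun t => (sqnorm (x k t - xinf))%:E) /\
    \int[P]_t sqnorm (x k t - xinf) <=
    2 / mu * ((1 - rho) ^+ k * energy Phi mu alpha xinf x0 xm1 + C / rho).
  have q0 : 0 <= 1 - rho by lra.
  have Cr0 : 0 <= C / rho := divr_ge0 C0 (ltW rho0).
  have V0 t : V 0%N t <= energy Phi mu alpha xinf x0 xm1 by [].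
  have [B [iB VB EB]] := mean_recursion q0 V0 stepV ia Ea Cr0 k.
  have iS : P.-integrable setT (fun t => (sqnorm (x k t - xinf))%:E).
    apply: integrableR_sum => c.
    have := sqint_lin 1 (- xinf c 0) (sx k c) (sqint_cst P 1).
    move=> /eq_sqint sc; apply: (sc (fun t => (x k t - xinf) c 0) _).2 => t.
    by rewrite mul1r mulr1 [RHS]mxE [X in _ = _ + X]mxE.
  split => //.
  have mu2 : 0 < 2 / mu by rewrite divr_gt0.
  (* Quadratic growth at the minimizer and the nonnegative square in [energy] give
     [mu / 2 * sqnorm (x k t - xinf) <= V k t], and [B] is an integrable majorant of [V k]. *)
  apply: (le_trans (y := \int[P]_t (2 / mu * B t))).
    apply: le_Rintegral => //; first exact: integrableRZ.
    move=> t _; rewrite -ler_pdivrMl// invf_div.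
    apply: (le_trans _ (VB t)); apply: (le_trans (minimizer_growth hmu lower xmin _)).
    rewrite /V /energy lerDr mulr_ge0 ?sqnorm_ge0//.
    by rewrite invr_ge0 mulr_ge0 ?(ltW a0).
  by rewrite RintegralZl// ler_pM2l.
(* Uses [rho = sqrt alpha * sqrt mu], so [alpha / rho] is [sqrt alpha / sqrt mu]. *)
have constE : 2 / mu * (C / rho) = sigma ^+ 2 * N%:R * Num.sqrt alpha /
    (mu * Num.sqrt mu) * (2 - lN + alpha * L).
  rewrite /C /rho aLam sqrtrM ?ltW//.
  have s0 : 0 < Num.sqrt alpha by rewrite sqrtr_gt0.
  have m0 : 0 < Num.sqrt mu by rewrite sqrtr_gt0.
  have {1}-> : alpha = Num.sqrt alpha ^+ 2 by rewrite sqr_sqrtr// ltW.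
  by field; rewrite !gt_eqF.
have bound k : ('E_P[fun t => sqnorm (x k t - xinf)%R] <=
      (2 * (1 - rho) ^+ k * (lyapunov f W alpha mu xinf xi0 / mu) +
       sigma ^+ 2 * N%:R * Num.sqrt alpha / (mu * Num.sqrt mu) *
         (2 - lN + alpha * L))%:E)%E.
  have [ik Ek] := main k.
  rewrite unlock -[leLHS]fineK ?integrable_fin_num// lee_fin -constE.
  rewrite /xi0 lyapunovE ?(ltW hmu)//.
  refine (le_trans Ek _); rewrite -/Phi.
  by rewrite le_eqVlt; apply/orP; left; apply/eqP; field; rewrite !gt_eqF.
split => // sigma0.
set K := sigma ^+ 2 * _ * _ / _ * _ in bound.
(* The variance is at most the second moment about [xinf], and the transient term of its bound
   vanishes because [0 < rho <= 1]. *)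
have limK : (limn_esup (fun k => vector_var P (x k)) <= K%:E)%E.
  apply: (limn_esup_le_lim (fun k => le_trans (vector_var_le xinf (sx k)) (bound k))).
  rewrite -[X in _ --> X]add0r; apply: cvgD; last exact: cvg_cst.
  rewrite -(mul0r (lyapunov f W alpha mu xinf xi0 / mu)); apply: cvgM; last exact: cvg_cst.
  rewrite -[X in _ --> X](mulr0 2); apply: cvgM; first exact: cvg_cst.
  by apply: cvg_expr; rewrite ger0_norm; lra.
have sN0 : 0 < sigma ^+ 2 * N%:R by rewrite mulr_gt0 ?exprn_gt0 ?ltr0n.
rewrite /J_infty; apply: (le_trans (lee_wpmul2l _ limK)).
  by rewrite lee_fin invr_ge0 ltW.
rewrite -EFinM lee_fin /K le_eqVlt; apply/orP; left; apply/eqP.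
have m0 : 0 < Num.sqrt mu by rewrite sqrtr_gt0.
by field; rewrite !gt_eqF// ltr0n.
Qed.
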